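(* Let $k\geq2$ be an integer and $C_0\geq1$. There are constants $K_0=K_0(k,C_0)$ and $C=C(k)$ such that the following holds. Let $N\geq1$, let $H$ be a positive integer, set $B=N/H$, assume $B\geq1$, let $L\geq2$ and $0<\eta<1$, and suppose that $\nu\colon[N]\to\mathbb R_{\geq0}$ satisfies the $(K,L,\eta)$ linear forms condition at scale $(N,B,H)$ with $K\geq K_0$. Set $$\eta_*=\eta+L^{-1}+H^{-1},\qquad c=2^{-2(k-1)}.$$ Let $\mu\colon\mathbb Z^{k-1}\to\mathbb C$ be $1$-bounded and supported on $([-C_0B,C_0B]\cap\mathbb Z)^{k-1}$. Let $S\subseteq\{2,\ldots,k\}$, and let $g_2,\ldots,g_k\colon\mathbb Z\to\mathbb C$ be supported on $[N]$ with $|g_i|\leq\nu$ for $i\in S$ and $|g_i|\leq1_{[N]}$ for $i\notin S$. Set $D=\mathcal D_\mu(g_2,\ldots,g_k)$, let $C_{\mathrm{sup}}\geq C_0$, set $K_{\mathrm{bd}}=(2C_{\mathrm{sup}}+1)^{k-1}$, and let $$D^\sharp(x)=1_{[N]}(x)\operatorname{clip}_{K_{\mathrm{bd}}}(D(x)).$$ Then $$\Bigl|\mathbb E_{x\in[N]}(\nu(x)-1)|D(x)|^2\Bigr|\ll_{k,C_0}\eta_*^c+R_\nu^C/B$$ and $$\mathbb E_{x\in[N]}|D(x)-D^\sharp(x)|^2\ll_{k,C_0}\eta_*^c+R_\nu^C/B.$$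
   Context: For a real number $X\geq1$, $[X]=\{1,\ldots,\lfloor X\rfloor\}$; $\mathbb E_{n\in S}$ is the average over a finite nonempty set. A function is $1$-bounded if its values have modulus at most $1$. Functions on $[N]$ are extended by zero to $\mathbb Z$. $X\ll_{k,C_0}Y$ means $X\leq C'Y$ with $C'$ depending only on $k,C_0$. $R_\nu=\max(1,\|\nu\|_{\ell^\infty([N])})$. For $R\geq1$ and $z\in\mathbb C$, $\operatorname{clip}_R(z)=z$ if $|z|\leq R$ and $\operatorname{clip}_R(z)=Rz/|z|$ if $|z|>R$. Normalised dual function: with $M=B^{k-2}N=B^{k-1}H$, $$\mathcal D_\mu(g_2,\ldots,g_k)(x)=\frac1M\sum_{\mathbf b=(b_2,\ldots,b_k)\in\mathbb Z^{k-1}}\mu(\mathbf b)\sum_{m\in[H]}\prod_{i=2}^kg_i(x+b_im).$$ Linear forms condition: let $N,B\geq1$, $H$ a positive integer, $K,L\geq2$, $0<\eta<1$. The function $\nu\colon[N]\to\mathbb R_{\geq0}$ satisfies the $(K,L,\eta)$ linear forms condition at scale $(N,B,H)$ if the following holds. Let $0\leq s\leq K$ and $1\leq J\leq K$ be integers, and let $I\subseteq[N]$ and $I_1,\ldots,I_s\subseteq[H]$ be intervals with $|I|\geq N/L$ and $|I_t|\geq H/L$ for $1\leq t\leq s$. For $1\leq j\leq J$ let $\Psi_j(x,\mathbf h)=x+a_j+\sum_{t=1}^sc_{j,t}h_t$ with integers $a_j,c_{j,t}$ satisfying $|a_j|\leq KN$, $|c_{j,t}|\leq KB$, and suppose the vectors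 $(c_{j,1},\ldots,c_{j,s})$, $1\leq j\leq J$, are pairwise distinct. Then for every $W_1,\ldots,W_J\in\{\nu,1_{[N]}\}$, $$\Bigl|\mathbb E_{x\in I}\mathbb E_{h_1\in I_1,\ldots,h_s\in I_s}\prod_{j=1}^JW_j(\Psi_j(x,\mathbf h))-\mathbb E_{x\in I}\mathbb E_{h_1\in I_1,\ldots,h_s\in I_s}\prod_{j=1}^J1_{[N]}(\Psi_j(x,\mathbf h))\Bigr|\leq\eta.$$ When $s=0$ the averages over the $h_t$ are omitted. *)

(* Defs.v *)
From mathcomp Require Import all_boot all_order all_algebra finmap.
From mathcomp Require Import all_classical all_reals all_analysis.
From mathcomp.real_closed Require Export complex.

Set Implicit Arguments.
Unset Strict Implicit.
Unset Printing Implicit Defensive.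

Import Order.TTheory GRing.Theory Num.Theory.

Local Open Scope classical_set_scope.
Local Open Scope ring_scope.
Local Open Scope complex_scope.

(* Modulus with values in [R]; the norm of [R[i]] takes its values in [R[i]]. *)
Definition cmod (R : realType) (z : R[i]) : R := ComplexField.Normc.normc z.

Definition bracket (R : realType) (X : R) : set int :=
  [set n : int | 1 <= n <= Num.floor X].

Definition card (T : choiceType) (A : set T) : nat := #|` fset_set A|%fset.

Definition avg (R : realType) (T : choiceType) (A : set T) (f : T -> R) : R :=
  (\sum_(x \in A) f x) / (card A)%:R.

Definition box (s : nat) (I : 'I_s -> set int) : set {ffun 'I_s -> int} :=
  [set h | forall t, I t (h t)].

Definition interval_in (A I : set int) : Prop := is_interval I /\ I `<=` A.

(* Functions on [N] are total functions on [int], extended by zero; for [s = 0]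
   the box is a singleton, so that the inner averages are vacuous. *)
Definition linear_forms_condition (R : realType) (K L eta N B : R) (H : nat)
    (nu : int -> R) : Prop :=
  forall s J : nat, s%:R <= K -> (1 <= J)%N -> J%:R <= K ->
  forall (I : set int) (Is : 'I_s -> set int),
    interval_in (bracket N) I -> N / L <= (card I)%:R ->
    (forall t, interval_in (bracket (H%:R : R)) (Is t)) ->
    (forall t, H%:R / L <= (card (Is t))%:R) ->
  forall (a : 'I_J -> int) (c : 'I_J -> {ffun 'I_s -> int}),
    (forall j, `|a j|%:~R <= K * N) ->
    (forall j t, `|c j t|%:~R <= K * B) ->
    injective c ->
  let Psi (j : 'I_J) (x : int) (h : {ffun 'I_s -> int}) : int :=
    x + a j + \sum_(t < s) c j t * h t in
  forall W : 'I_J -> int -> R,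
    (forall j, W j = nu \/ W j = \1_(bracket N)) ->
  `| avg I (fun x => avg (box Is) (fun h => \prod_(j < J) W j (Psi j x h)))
   - avg I (fun x => avg (box Is)
       (fun h => \prod_(j < J) (\1_(bracket N) (Psi j x h) : R))) | <= eta.

Definition linfty_norm (R : realType) (N : R) (nu : int -> R) : R :=
  sup [set `|nu x| | x in bracket N].

Definition Rnu (R : realType) (N : R) (nu : int -> R) : R :=
  Num.max 1 (linfty_norm N nu).

Definition clip (R : realType) (r : R) (z : R[i]) : R[i] :=
  if cmod z <= r then z else r%:C * z / (cmod z)%:C.

(* The indices 2, ..., k are represented by 'I_k.-1: the ordinal [i] stands for
   [i + 2]. The sum over all [b] is over the finite support of the summand; it
   is only used for [mu] of finite support. *)
Definition dual_function (R : realType) (k : nat) (N B : R) (H : nat)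
    (mu : {ffun 'I_k.-1 -> int} -> R[i]) (g : 'I_k.-1 -> int -> R[i])
    (x : int) : R[i] :=
  ((B ^+ (k - 2) * N)^-1)%:C *
  \sum_(b \in [set: {ffun 'I_k.-1 -> int}])
    (mu b * \sum_(m \in bracket (H%:R : R)) \prod_(i < k.-1) g i (x + b i * m)).

(* Main.v *)
Require Import Defs.
From mathcomp Require Import all_boot all_order all_algebra finmap.
From mathcomp Require Import all_classical all_reals all_analysis.
From mathcomp Require Import ring lra zify.

(** Expanding |D|^2 writes both averages as sums over pairs (b, b') of counts
    along the forms x, x + b_i m and x + b'_i m'.  Pairs for which the 2(k-1)
    numbers b_i, b'_i are not distinct and nonzero are a proportion O(1/B) and
    are bounded trivially.  For the others, translate m and m' by y_1 + ... + y_n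
    (n = 2(k-1), with y_j in a short range of length about H/L) and x by - sum_j b_j y_j: the j-th
    factor no longer depends on y_j, so n applications of Cauchy-Schwarz, each
    dominating one factor by its majorant, leave an average of products of nu
    and nu - 1 over forms with distinct coefficient vectors, which is O(eta) by
    the linear forms condition.  For the second bound, |D - D#| is dominated by
    the difference of the two envelopes of D, computed from the majorants and
    from the indicator function, whose square is again a linear forms average. *)

Set Implicit Arguments.
Unset Strict Implicit.
Unset Printing Implicit Defensive.

Import Order.TTheory GRing.Theory Num.Theory.

Local Open Scope classical_set_scope.
Local Open Scope ring_scope.
Local Open Scope complex_scope.

(** * Gowers-Cauchy-Schwarz *)

Section CauchySchwarz.
Variable R : realFieldType.

(** The weight nu is unbounded and pointwise bounds lose powers of R_nu, so even the boundary strips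
    created by translating m and m' are counted by the linear forms condition. That condition only
    sees intervals of length at least H/L, hence the range of the y_j; translating costs L^-1 +
    H^-1, the second term coming from rounding. Pointwise bounds are affordable only for the
    degenerate pairs, where n + 1 factors give C = n + 1. Each Cauchy-Schwarz step halves the
    exponent of eta, whence c = 2^-n. Distinct nonzero shifts are what separates the coefficient
    vectors after duplication: y_k has coefficient -b_k in a copy of nu - 1 and b_i - b_k in a copy
    of the i-th majorant. The average of the indicator forms is never evaluated: it carries a
    coefficient 1 - 1 = 0, or cancels between the four terms of a squared difference, or is bounded
    by its number of terms. Cauchy-Schwarz is carried out over the reals; complex weights are split
    into real and imaginary parts at a cost of 2^n. *)

Lemma weighted_cauchy_schwarz (T : finType) (v s : T -> R) :
  (forall t, 0 <= v t) ->
  (\sum_t v t * s t) ^+ 2 <= (\sum_t v t) * \sum_t v t * s t ^+ 2.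
Proof.
move=> v0.
have : 0 <= \sum_k \sum_l v k * v l * (s k - s l) ^+ 2.
  apply: sumr_ge0 => k _; apply: sumr_ge0 => l _.
  by apply: mulr_ge0; [exact: mulr_ge0|exact: sqr_ge0].
(* Lagrange's identity: the double sum is twice the Cauchy-Schwarz deficit. *)
have -> : \sum_k \sum_l v k * v l * (s k - s l) ^+ 2 =
    2 * ((\sum_t v t) * \sum_t v t * s t ^+ 2) - 2 * (\sum_t v t * s t) ^+ 2.
  rewrite (eq_bigr (fun k => v k * s k ^+ 2 * (\sum_t v t)
      + v k * (\sum_t v t * s t ^+ 2) - 2 * (v k * s k * \sum_t v t * s t))).
    rewrite !big_split /= -!mulr_suml sumrN -mulr_sumr -mulr_suml; ring.
  move=> k _; rewrite !mulr_sumr -sumrN -!big_split /=.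
  by apply: eq_bigr => l _; ring.
lra.
Qed.

Lemma dominated_cauchy_schwarz (T : finType) (a v s : T -> R) :
  (forall t, `|a t| <= v t) ->
  (\sum_t a t * s t) ^+ 2 <= (\sum_t v t) * \sum_t v t * s t ^+ 2.
Proof.
move=> av; have v0 t : 0 <= v t := le_trans (normr_ge0 _) (av t).
apply: le_trans (_ : (\sum_t v t * `|s t|) ^+ 2 <= _).
  rewrite -[leLHS]real_normK ?num_real // lerXn2r ?nnegrE //.
    by apply: sumr_ge0 => t _; rewrite mulr_ge0.
  apply: le_trans (ler_norm_sum _ _ _) _; apply: ler_sum => t _.
  by rewrite normrM ler_wpM2r.
rewrite (eq_bigr (fun t => v t * `|s t| ^+ 2) (F1 := fun t => v t * s t ^+ 2)).
  exact: weighted_cauchy_schwarz.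
by move=> t _; rewrite real_normK ?num_real.
Qed.

End CauchySchwarz.

(** * Changing one coordinate *)

Section Update.
Variable I : finType.

Definition upd (T : Type) (f : {ffun I -> T}) (i : I) (p : T) : {ffun I -> T} :=
  [ffun j => if j == i then p else f j].

Lemma upd_eq (T : Type) (f : {ffun I -> T}) i p : upd f i p i = p.
Proof. by rewrite ffunE eqxx. Qed.

Lemma upd_neq (T : Type) (f : {ffun I -> T}) i j p : j != i -> upd f i p j = f j.
Proof. by rewrite ffunE => /negbTE->. Qed.

Lemma upd_upd (T : Type) (f : {ffun I -> T}) i p q : upd (upd f i p) i q = upd f i q.
Proof. by apply/ffunP => j; rewrite !ffunE; case: eqP. Qed.

Lemma upd_id (T : Type) (f : {ffun I -> T}) i : upd f i (f i) = f.
Proof. by apply/ffunP => j; rewrite !ffunE; case: eqP => [->|]. Qed.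

(** The involution (u, p) -> (upd u i p, u i) exposes coordinate [i] as a free variable; the old
    value is summed idly, which gives the factor [#|T|]. *)
Lemma sum_upd (R : pzSemiRingType) (T : finType) (f : {ffun I -> T} -> R) i :
  \sum_u \sum_p f (upd u i p) = #|T|%:R * \sum_u f u.
Proof.
rewrite pair_big /= (reindex_inj (h := fun up => (upd up.1 i up.2, up.1 i))) /=.
  rewrite -(pair_bigA _ (fun u p => f (upd (upd u i p) i (u i)))) /=.
  rewrite mulr_sumr; apply: eq_bigr => u _.
  under eq_bigr do rewrite upd_upd upd_id.
  by rewrite sumr_const mulr_natl.
apply: (can_inj (g := fun up => (upd up.1 i up.2, up.1 i))) => -[u p] /=.
by rewrite upd_upd upd_id upd_eq.
Qed.

End Update.

(** * Duplication of coordinates, as in Gowers box norms *)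

Section BoxNorm.
Import mathcomp.boot.fintype mathcomp.boot.finset.
Variables (R : realFieldType) (X I Y : finType).
Implicit Types (phi : {ffun I -> Y} -> R) (u : {ffun I -> Y * Y}) (E w : {set I}).

Definition sel w u : {ffun I -> Y} :=
  [ffun i => if i \in w then (u i).2 else (u i).1].

Definition cube_prod E phi u : R := \prod_(w : {set I} | w \subset E) phi (sel w u).

Definition swap_at i u := upd u i ((u i).2, (u i).1).

Definition indep phi i := forall v p, phi (upd v i p) = phi v.

Lemma sel_upd w u i p : sel w (upd u i p) = upd (sel w u) i (if i \in w then p.2 else p.1).
Proof. by apply/ffunP => j; rewrite !ffunE; case: (j =P i) => [->|]. Qed.

Lemma sel_setU1 w u i : i \notin w -> sel (i |: w) u = sel w (swap_at i u).
Proof.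
move=> iw; apply/ffunP => j; rewrite !ffunE in_setU1.
by case: (j =P i) => [->|] //=; rewrite (negbTE iw).
Qed.

(** The vertices of the larger cube are split by whether they contain [i]; adding [i] to a vertex
    amounts to swapping the two copies of that coordinate. *)
Lemma cube_prod_setU1 E phi u i : i \notin E ->
  cube_prod (i |: E) phi u = cube_prod E phi u * cube_prod E phi (swap_at i u).
Proof.
move=> iE; rewrite /cube_prod (bigID (fun w : {set I} => i \in w)) /= mulrC; congr (_ * _).
  apply: eq_bigl => w; apply/andP/idP => [[wE iw]|wE].
    apply/subsetP => j jw; move/subsetP: wE => /(_ j jw); rewrite in_setU1.
    by case/orP => [/eqP ji|//]; rewrite -ji jw in iw.
  by split; [apply: subset_trans wE (subsetUr _ _)|apply: contra iE; apply: (subsetP wE)].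
rewrite (reindex_onto (fun w => i |: w) (fun w => w :\ i)) /=; last first.
  by move=> w /andP[_ iw]; rewrite setD1K.
apply: eq_big => [w|w].
  rewrite setU11 andbT; apply/andP/idP => [[wE /eqP wi]|wE].
    have iw : i \notin w by rewrite -wi !inE eqxx.
    apply/subsetP => j jw; move/subsetP: wE => /(_ j).
    rewrite !in_setU1 jw orbT => /(_ isT) /orP[/eqP ji|//].
    by rewrite ji (negbTE iw) in jw.
  split; first exact: setUS.
  by rewrite setU1K //; apply: contra iE; apply: (subsetP wE).
move=> /andP[_ /eqP wi]; rewrite sel_setU1 //; first by rewrite -wi !inE eqxx.
Qed.

Lemma cube_prod_indep E phi u i p : indep phi i ->
  cube_prod E phi (upd u i p) = cube_prod E phi u.
Proof. by move=> ind; apply: eq_bigr => w _; rewrite sel_upd ind. Qed.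

Lemma cube_prod_upd E phi u i p p' : i \notin E -> p.1 = p'.1 ->
  cube_prod E phi (upd u i p) = cube_prod E phi (upd u i p').
Proof.
move=> iE pp; apply: eq_bigr => w wE; rewrite !sel_upd.
have /negbTE-> : i \notin w by apply: contra iE; apply: (subsetP wE).
by rewrite pp.
Qed.

Lemma cube_prod_norm_le E phi psi u : (forall v, `|phi v| <= psi v) ->
  `|cube_prod E phi u| <= cube_prod E psi u.
Proof. by move=> pp; rewrite normr_prod; apply: ler_prod => w _; rewrite normr_ge0 pp. Qed.

Variables (F : X -> {ffun I -> Y} -> R) (G V : I -> X -> {ffun I -> Y} -> R).
Hypothesis Gindep : forall i x, indep (G i x) i.
Hypothesis Vindep : forall i x, indep (V i x) i.
Hypothesis GV : forall i x v, `|G i x v| <= V i x v.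
Hypothesis Y0 : (0 < #|Y|)%N.

(* The form after duplicating the coordinates in E: factors G j with j \in E have been
   replaced by their majorants V j, which do not depend on coordinate j.  Second
   components outside E are idle and only keep the normalisation independent of E. *)
Definition partial_form E : R := \sum_x \sum_u
  cube_prod E (F x) u * \prod_(j | j \notin E) cube_prod E (G j x) u
    * \prod_(j in E) cube_prod (E :\ j) (V j x) u.

(** Since [G i] ignores coordinate [i], it comes out of the sum over that coordinate and is
    dominated by [V i]; expanding the square of the remaining inner sum duplicates coordinate [i] in
    every other factor. *)
Lemma partial_form_step E i : i \notin E ->
  partial_form E ^+ 2 <=
  (\sum_x \sum_u cube_prod E (V i x) u) * partial_form (i |: E).
Proof.
move=> iE.
(* [r] gathers all factors except [G i]; [s] sums it over the first component of coordinate [i], the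
   only one that it reads because [i \notin E]. *)
pose r x u := cube_prod E (F x) u
  * \prod_(j | (j \notin E) && (j != i)) cube_prod E (G j x) u
  * \prod_(j in E) cube_prod (E :\ j) (V j x) u.
pose a (xu : X * {ffun I -> Y * Y}) := cube_prod E (G i xu.1) xu.2.
pose v (xu : X * {ffun I -> Y * Y}) := cube_prod E (V i xu.1) xu.2.
pose s (xu : X * {ffun I -> Y * Y}) := \sum_y r xu.1 (upd xu.2 i (y, (xu.2 i).2)).
have r_upd x u p p' : p.1 = p'.1 -> r x (upd u i p) = r x (upd u i p').
  move=> pp; rewrite /r (cube_prod_upd _ _ iE pp); congr (_ * _ * _).
    by apply: eq_bigr => j _; rewrite (cube_prod_upd _ _ iE pp).
  apply: eq_bigr => j _; rewrite (@cube_prod_upd _ _ _ _ p p') //.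
  by rewrite !inE negb_and iE orbT.
have Y0' : #|Y|%:R != 0 :> R by rewrite pnatr_eq0 -lt0n.
(* Components of [u] that are overwritten are still summed over; the resulting powers of [#|Y|] in
   [QE] and [QS] match after squaring. *)
have QE : #|Y|%:R * partial_form E = \sum_xu a xu * s xu.
  rewrite -(pair_bigA _ (fun x u => a (x, u) * s (x, u))) /=.
  rewrite mulr_sumr; apply: eq_bigr => x _.
  apply: (mulfI Y0'); rewrite mulrA -natrM -card_prod -(sum_upd _ i) mulr_sumr.
  apply: eq_bigr => u _.
  transitivity (\sum_p a (x, u) * r x (upd u i p)).
    apply: eq_bigr => p _; rewrite /r (bigD1 i) //= (cube_prod_indep _ _ _ (Gindep i x)).
    by rewrite /a /=; ring.
  rewrite -mulr_sumr mulrCA; congr (_ * _).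
  rewrite (eq_bigr (fun p => r x (upd u i (p.1, p.2)))); last by case.
  rewrite -(pair_bigA _ (fun y z => r x (upd u i (y, z)))) /= /s mulr_sumr.
  apply: eq_bigr => y _; rewrite (eq_bigr (fun=> r x (upd u i (y, (u i).2)))).
    by rewrite sumr_const mulr_natl.
  by move=> z _; apply: r_upd.
(* The two summation variables of the square become the pair stored at coordinate [i]. *)
have QS : \sum_xu v xu * s xu ^+ 2 = #|Y|%:R ^+ 2 * partial_form (i |: E).
  rewrite -(pair_bigA _ (fun x u => v (x, u) * s (x, u) ^+ 2)) /=.
  rewrite mulr_sumr; apply: eq_bigr => x _.
  rewrite expr2 -natrM -card_prod -(sum_upd _ i); apply: eq_bigr => u _.
  rewrite expr2 /s mulr_suml mulr_sumr.
  pose f u := cube_prod (i |: E) (F x) u * \prod_(j | j \notin i |: E) cube_prod (i |: E) (G j x) u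
    * \prod_(j in i |: E) cube_prod ((i |: E) :\ j) (V j x) u.
  rewrite [RHS](eq_bigr (fun p => f (upd u i (p.1, p.2)))); last by case.
  rewrite -(pair_bigA _ (fun y z => f (upd u i (y, z)))) /=.
  apply: eq_bigr => y _; rewrite mulr_sumr mulr_sumr; apply: eq_bigr => z _; rewrite /f.
  rewrite cube_prod_setU1 // /swap_at upd_eq upd_upd /=.
  rewrite (r_upd _ _ (y, (u i).2) (y, z)) // (r_upd _ _ (z, (u i).2) (z, y)) //.
  rewrite (eq_bigr (P := fun j => j \notin i |: E) (fun j =>
     cube_prod E (G j x) (upd u i (y, z)) * cube_prod E (G j x) (upd u i (z, y)))); last first.
    by move=> j _; rewrite cube_prod_setU1 // /swap_at upd_eq upd_upd.
  rewrite (eq_bigl (fun j => (j \notin E) && (j != i))); last first.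
    by move=> j; rewrite !inE negb_or andbC.
  rewrite (bigD1 (P := fun j => j \in i |: E) i) ?setU11 //= setU1K //.
  rewrite (eq_big (P1 := fun j => (j \in i |: E) && (j != i)) (fun j => j \in E) (fun j =>
     cube_prod (E :\ j) (V j x) (upd u i (y, z)) *
     cube_prod (E :\ j) (V j x) (upd u i (z, y)))); first last.
  - move=> j /andP[_ ji]; rewrite setDUl.
    have -> : [set i] :\ j = [set i]%SET.
      by apply/setP => l; rewrite !inE; case: (l =P i) => [->|]; rewrite ?andbF // eq_sym ji.
    by rewrite cube_prod_setU1 ?inE ?negb_and ?iE ?orbT // /swap_at upd_eq upd_upd.
  - move=> j; rewrite !inE; case: (j =P i) => [->|] /=; last by rewrite andbT.
    by rewrite (negbTE iE).
  rewrite !big_split /= /v /= (cube_prod_indep _ _ _ (Vindep i x)) /r; ring.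
have av xu : `|a xu| <= v xu by apply: cube_prod_norm_le => ?; apply: GV.
have Y2 : 0 < #|Y|%:R ^+ 2 :> R by rewrite exprn_gt0 ?ltr0n.
have := dominated_cauchy_schwarz s av.
rewrite -QE QS exprMn [X in _ <= X -> _]mulrCA (ler_pM2l Y2).
by rewrite -(pair_bigA _ (fun x u => v (x, u))).
Qed.

Variable (D : R).
Hypothesis D0 : 0 < D.
Hypothesis VD : forall (E : {set I}) i, i \notin E ->
  \sum_x \sum_u cube_prod E (V i x) u <= 2 * D.

(** [partial_form_step] is iterated over the coordinates. Normalised by [D], the majorant sum costs
    a factor 2 each time, and this exponent of 2 doubles and gains one at every step, reaching 2 ^ n
    - 1. *)
Lemma box_cauchy_schwarz :
  `|partial_form set0 / D| ^+ (2 ^ #|I|) <= 2 ^+ (2 ^ #|I|) * `|partial_form setT / D|.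
Proof.
suff gen n : forall E, (#|~: E| = n)%N ->
    `|partial_form E / D| ^+ (2 ^ n) <= 2 ^+ (2 ^ n - 1) * `|partial_form setT / D|.
  apply: le_trans (gen #|I| set0 _) _; first by rewrite setC0 cardsT.
  by apply: ler_wpM2r => //; apply: ler_weXn2l; [lra | apply: leq_subr].
elim: n => [E /eqP|n IHn E En].
  rewrite cards_eq0 => /eqP E0; have -> : E = setT by rewrite -[E]setCK E0 setC0.
  by rewrite subnn expr0 mul1r expn0 expr1.
have /card_gt0P : (0 < #|~: E|)%N by rewrite En.
case=> i; rewrite inE => iE.
have En' : (#|~: (i |: E)| = n)%N.
  have := cardsD1 i (~: E); rewrite inE iE En add1n => -[->].
  by congr #|pred_of_set _|; apply/setP => j; rewrite !inE negb_or andbC.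
have step : `|partial_form E / D| ^+ 2 <= 2 * `|partial_form (i |: E) / D|.
  have Dp : 0 <= D by exact: ltW.
  rewrite !normrM normfV (ger0_norm Dp) exprMn exprVn ler_pdivrMr ?exprn_gt0 //.
  rewrite real_normK ?num_real //; apply: le_trans (partial_form_step iE) _.
  have -> : 2 * (`|partial_form (i |: E)| / D) * D ^+ 2 = 2 * D * `|partial_form (i |: E)|.
    by field; rewrite gt_eqF.
  apply: le_trans (ler_norm _) _; rewrite normrM ler_wpM2r // ger0_norm ?VD //.
  apply: sumr_ge0 => x _; apply: sumr_ge0 => u _; apply: prodr_ge0 => w _.
  exact: le_trans (normr_ge0 _) (GV _ _ _).
rewrite expnS exprM.
apply: le_trans (_ : (2 * `|partial_form (i |: E) / D|) ^+ (2 ^ n) <= _).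
  by rewrite lerXn2r ?nnegrE ?exprn_ge0 // mulr_ge0.
rewrite exprMn.
have -> : (2 * 2 ^ n - 1 = 2 ^ n + (2 ^ n - 1))%N by have := expn_gt0 2 n; lia.
by rewrite exprD -mulrA ler_wpM2l ?exprn_ge0 // IHn.
Qed.

End BoxNorm.

(** * Finite averages *)

Section Averages.
Variable R : realType.

(** Sums over subsets of [int] or of function spaces are moved to a [finType] by an explicit
    enumeration [h], so that later work is about big operators only. *)
Lemma fsum_reindex (V : nmodType) (T : choiceType) (W : finType) (A : set T) (h : W -> T) (f : T -> V) :
  injective h -> (forall x, A x <-> exists w, x = h w) ->
  Defs.card A = #|W| /\ \sum_(x \in A) f x = \sum_w f (h w).
Proof.
move=> hinj Ah.
have -> : A = [set` [fset h w | w in W]%fset].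
  apply/seteqP; split=> x /=.
    by move=> /Ah[w ->]; apply/imfsetP; exists w.
  by move=> /imfsetP[w _ ->]; apply/Ah; exists w.
have fin : finite_set [set` [fset h w | w in W]%fset] by exact: finite_fset.
have cW : #|` [fset h w | w in W]|%fset = #|W| by rewrite card_imfset // cardE.
rewrite /Defs.card set_fsetK cW fsbig_finite // set_fsetK big_imfset //=; last exact: in2W.
by rewrite big_enum.
Qed.

Lemma avg_reindex (T : choiceType) (W : finType) (A : set T) (h : W -> T) (f : T -> R) :
  injective h -> (forall x, A x <-> exists w, x = h w) ->
  Defs.card A = #|W| /\ avg A f = (\sum_w f (h w)) / #|W|%:R.
Proof. by move=> hinj Ah; have [cA sA] := fsum_reindex f hinj Ah; rewrite /avg cA sA. Qed.

Lemma bracket_floor (N : R) (nn : nat) : nn%:R <= N < nn.+1%:R ->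
  bracket N = [set x : int | 1 <= x <= nn%:Z].
Proof.
move=> /andP[N1 N2]; rewrite /bracket; suff -> : Num.floor N = nn%:Z by [].
by apply: floor_def; rewrite N1 /= addrC -intS.
Qed.

Lemma bracket_ord (nn : nat) (x : int) :
  (1 <= x <= nn%:Z) <-> exists i : 'I_nn, x = i.+1%:Z.
Proof.
split=> [|[i ->]]; last by have := ltn_ord i; lia.
case: x => [[|x]|x] //= xn.
have xlt : (x < nn)%N by lia.
by exists (Ordinal xlt).
Qed.

End Averages.

(** * Shifts, blocks and windows of finite sums *)

Section FiniteSums.
Variable R : realType.

Lemma norm_prod_le1 (T : finType) (P : pred T) (f : T -> R) :
  (forall j, P j -> `|f j| <= 1) -> `|\prod_(j | P j) f j| <= 1.
Proof.
move=> f1; rewrite normr_prod; apply: Num.Theory.prodr_ile1 => j Pj.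
by rewrite normr_ge0 f1.
Qed.

Lemma PoszD_sum (T : finType) (f : T -> nat) : (\sum_j f j)%N%:Z = \sum_j (f j)%:Z.
Proof. exact: (big_morph _ PoszD). Qed.

Lemma sum_nat_offset (V : nmodType) (a n : nat) (f : nat -> V) :
  \sum_(a <= j < a + n) f j = \sum_(m < n) f (m + a)%N.
Proof. by rewrite -[X in \sum_(X <= _ < _) _]add0n big_addn addKn big_mkord. Qed.

Lemma sum_blocks (V : nmodType) (T n : nat) (f : nat -> V) :
  \sum_(t < T) \sum_(x < n) f (t * n + x)%N = \sum_(0 <= j < T * n) f j.
Proof.
elim: T => [|T IH]; first by rewrite big_ord0 mul0n big_geq.
rewrite big_ord_recr /= IH mulSn addnC [RHS](big_cat_nat (n := T * n)) ?leq_addr //=.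
congr (_ + _); rewrite sum_nat_offset.
by apply: eq_bigr => x _; rewrite addnC.
Qed.

(** The sum of the first n + y terms is cut in two ways, after n and after y terms. *)
Lemma sum_shift (n y : nat) (f : nat -> R) :
  \sum_(m < n) f m - \sum_(m < n) f (m + y)%N
  = \sum_(m < y) f m - \sum_(m < y) f (m + n)%N.
Proof.
have e a b : \sum_(m < a) f m + \sum_(m < b) f (m + a)%N = \sum_(0 <= m < a + b) f m.
  rewrite [RHS](big_cat_nat (n := a)) ?leq_addr //= big_mkord; congr (_ + _).
  by rewrite sum_nat_offset.
by have := e n y; have := e y n; rewrite addnC => <- ?; lra.
Qed.

Lemma ler_sum_ord_widen (a l : nat) (f : nat -> R) : (forall m, 0 <= f m) -> (a <= l)%N ->
  \sum_(m < a) f m <= \sum_(m < l) f m.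
Proof.
move=> f0 al; rewrite -!(big_mkord xpredT f) [leRHS](big_cat_nat (n := a)) //=.
by rewrite lerDl sumr_ge0.
Qed.

Lemma centered_index (T : nat) (t : 'I_(2 * T).+1) : `|t%:Z - T%:Z| <= T%:Z.
Proof. by have := ltn_ord t; lia. Qed.

(** The 2T + 1 translates of [n] tile one long interval, and the bound on [s] keeps the translated
    support inside it. This makes the change of variable x -> x - s exact, without boundary
    terms. *)
Lemma sum_window (T n : nat) (s : int) (f : int -> R) :
  (forall x, ~~ (1 <= x <= n%:Z) -> f x = 0) -> `|s| <= T%:Z * n%:Z ->
  \sum_(t < (2 * T).+1) \sum_(x < n) f (x.+1%:Z + (t%:Z - T%:Z) * n%:Z - s)
  = \sum_(x < n) f x.+1%:Z.
Proof.
move=> f0 sT.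
(* The translated support occupies the positions a, ..., a + n - 1 of the long interval. *)
have [a aE] : exists a : nat, a%:Z = T%:Z * n%:Z + s.
  by exists `|(T%:Z * n%:Z + s)%R|%N; lia.
have aT : (a + n <= (2 * T).+1 * n)%N by nia.
transitivity (\sum_(0 <= j < (2 * T).+1 * n) f (j.+1%:Z - a%:Z)).
  rewrite -(sum_blocks _ _ (fun j => f (j.+1%:Z - a%:Z))).
  apply: eq_bigr => t _; apply: eq_bigr => x _; congr f; rewrite aE; lia.
rewrite (big_cat_nat (n := a)) //=; last by lia.
rewrite big_nat big1 => [|j /andP[_ ja]]; last by apply: f0; lia.
rewrite add0r (big_cat_nat (n := (a + n)%N)) ?leq_addr //=.
rewrite [X in _ + X]big_nat [X in _ + X]big1 => [|j /andP[ja _]]; last by apply: f0; lia.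
rewrite addr0 sum_nat_offset.
by apply: eq_bigr => x _; congr f; lia.
Qed.

End FiniteSums.

(** * Elementary real inequalities *)

Section Inequalities.
Variable R : realType.

Lemma one_add_le_double (c e : R) : 1 <= c -> 0 <= e <= 1 -> 1 + c * e <= 2 * c.
Proof. by move=> c1 /andP[? ?]; nra. Qed.

Lemma root_le_powR (z c e : R) (n : nat) : 0 <= z -> 0 <= c -> 0 <= e ->
  z ^+ (2 ^ n) <= c ^+ (2 ^ n) * e -> z <= c * e `^ (2 ^+ n)^-1.
Proof.
move=> z0 c0 e0 zce.
have p0 : (0 : R) < 2 ^+ n by rewrite exprn_gt0.
rewrite -(@ler_pXn2r _ (2 ^ n)) ?expn_gt0 ?nnegrE ?mulr_ge0 ?powR_ge0 //.
rewrite exprMn -[X in _ <= _ * X]powR_mulrn ?powR_ge0 // -powRrM natrX mulVf ?gt_eqF //.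
by rewrite powRr1.
Qed.

Lemma norm_sub4_le (x y z w c : R) : `|x| <= c -> `|y| <= c -> `|z| <= c -> `|w| <= c ->
  `|x - y + (z - w)| <= 4 * c.
Proof. by rewrite !ler_norml => /andP[? ?] /andP[? ?] /andP[? ?] /andP[? ?]; lra. Qed.

(** For the case where the total translation can exceed H: then 1 <= n d, and a trivial bound
    already has the size claimed. *)
Lemma short_range_le (pc M n a e d : R) : 0 <= pc -> 0 <= M -> 0 <= a -> 0 <= n -> 0 <= e ->
  1 <= n * d -> pc * M <= (a + 4 * pc * n) * M * (e + d).
Proof.
move=> pc0 M0 a0 n0 e0 nd.
have d0 : 0 <= d.
  rewrite leNgt; apply/negP => /ltW d0.
  by have := mulr_ge0_le0 n0 d0; lra.
have pM : 0 <= pc * M by rewrite mulr_ge0.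
have h1 : 0 <= a * M * (e + d) by rewrite !mulr_ge0 ?addr_ge0.
have h2 : 0 <= pc * n * M * e by rewrite !mulr_ge0.
have h3 : 0 <= pc * M * (n * d - 1) by rewrite mulr_ge0 // subr_ge0.
by nra.
Qed.

(** [U] is the number of shift vectors, [S] the count to be bounded, [p] the sum of its translates.
    The first hypothesis is the cost of translating, the second the outcome of Cauchy-Schwarz. *)
Lemma shifted_count_le (U S p pc Q M n a T e d : R) :
  `|U * S - p| <= U * (4 * (pc * Q)) -> `|p| <= 2 * (a * (T * (M * U))) * e ->
  0 <= U -> 0 <= pc -> 0 <= M -> 0 <= 2 * (a * T) -> 0 <= e -> 0 <= d -> 0 <= n ->
  Q <= M * (n * d) ->
  `|U * S| <= U * ((2 * (a * T) + 4 * pc * n) * M * (e + d)).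
Proof.
move=> h1 h2 U0 pc0 M0 aT0 e0 d0 n0 QM.
rewrite -[X in `|X|](subrK p); apply: le_trans (ler_normD _ _) _.
apply: le_trans (lerD h1 h2) _.
have g1 : U * (4 * (pc * Q)) <= U * (4 * (pc * (M * (n * d)))).
  by do 3!apply: ler_wpM2l => //.
have g2 : 0 <= 2 * (a * T) * (U * M * d) by apply: mulr_ge0 => //; rewrite !mulr_ge0.
have g3 : 0 <= pc * n * (U * M * e) by rewrite !mulr_ge0.
have -> : U * ((2 * (a * T) + 4 * pc * n) * M * (e + d)) =
  U * (4 * (pc * (M * (n * d)))) + 2 * (a * (T * (M * U))) * e
  + (2 * (a * T) * (U * M * d) + 4 * (pc * n * (U * M * e))) by ring.
lra.
Qed.

Lemma window_upper_le (P S M c e X : R) : 0 <= P <= 1 -> 0 <= S <= M -> 0 <= c -> 0 <= e <= 1 ->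
  X - (1 + 1) * P * S <= c * e * M -> X <= (2 + c) * M.
Proof.
move=> /andP[P0 P1] /andP[S0 SM] c0 /andP[e0 e1] XM.
have h1 : P * S <= 1 * M by rewrite ler_pM.
have h2 : c * e * M <= c * 1 * M by rewrite ler_wpM2r ?ler_wpM2l // (le_trans S0).
lra.
Qed.

(** Below 1 a smaller exponent increases the power; above 1 the power is at least 1 and x <= 3. It
    is applied to eta + L^-1 + H^-1, which never exceeds 3. *)
Lemma le_three_powR (x c : R) : 0 <= x -> x <= 3 -> 0 < c -> c <= 1 -> x <= 3 * x `^ c.
Proof.
move=> x0 x3 c0 c1; have p0 : 0 <= x `^ c by apply: powR_ge0.
have [x1|x1] := leP x 1.
  have [->|xn0] := eqVneq x 0; first by rewrite mulr_ge0 ?powR_ge0.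
  have xp : 0 < x by rewrite lt_neqAle eq_sym xn0.
  apply: le_trans (_ : x `^ c <= _); last by lra.
  by apply: ger1_powR; rewrite ?xp.
have : 1 `^ c <= x `^ c by apply: ge0_ler_powR; rewrite ?nnegrE // ltW.
by rewrite powR1 => ?; lra.
Qed.

Lemma generic_total_le (u b h c G1 G2 m e r n : R) :
  0 <= u -> 0 <= b -> 0 <= h -> 0 <= c -> 0 <= G1 -> 0 <= G2 -> 0 <= m -> 0 <= e -> 0 <= r ->
  0 <= n ->
  c * b * (u * (G1 * (n * (h * h) * e)) + m * (u * (G2 * (n * (h * h) * r))))
  <= u * (b * (h * h) * (c * (G1 + m * G2) * (e + r) * n)).
Proof.
move=> u0 b0 h0 c0 G10 G20 m0 e0 r0 n0; rewrite -subr_ge0.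
have -> : u * (b * (h * h) * (c * (G1 + m * G2) * (e + r) * n)) -
  c * b * (u * (G1 * (n * (h * h) * e)) + m * (u * (G2 * (n * (h * h) * r)))) =
  c * b * u * n * (h * h) * (G1 * r + m * G2 * e) by ring.
by apply: mulr_ge0; [rewrite !mulr_ge0 | rewrite addr_ge0 ?mulr_ge0].
Qed.

Lemma convex_between (a v y c : R) : 0 <= a -> a <= 1 -> 0 <= v -> v <= c -> 0 <= y -> y <= c ->
  0 <= a * v + (1 - a) * y <= c.
Proof.
move=> a0 a1 v0 vc y0 yc; have b0 : 0 <= 1 - a by rewrite subr_ge0.
rewrite addr_ge0 ?mulr_ge0 //=.
have h1 := ler_wpM2l a0 vc; have h2 := ler_wpM2l b0 yc; lra.
Qed.

Lemma fourfold_error_le (c X t e : R) : 0 <= c -> 0 <= X -> t <= 3 * e ->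
  4 * (c * t * X) <= 12 * c * (X * e).
Proof. by move=> c0 X0 te; have := ler_wpM2l (mulr_ge0 c0 X0) te; lra. Qed.

End Inequalities.

(** * Linear forms over arbitrary finite index types *)

Section LinearForms.
Variables (R : realType) (K L eta N B : R) (H nn : nat) (nu : int -> R).
Hypothesis lfc : linear_forms_condition K L eta N B H nu.
Hypothesis nnN : nn%:R <= N < nn.+1%:R.
Hypothesis nn0 : (0 < nn)%N.
Hypothesis L2 : 2 <= L.
Hypothesis K0 : 0 <= K.
Hypothesis eta0 : 0 <= eta.

Definition indN (x : int) : R := ((1 <= x <= nn%:Z)%R)%:R.

Lemma indic_bracket : \1_(bracket N) = indN.
Proof.
apply/funext => x; rewrite (bracket_floor nnN) indicE /indN.
congr ((nat_of_bool _)%:R); by apply/idP/idP; rewrite inE.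
Qed.

Lemma is_interval_int_cc (u v : int) : is_interval [set x : int | u <= x <= v].
Proof. by move=> x y /= ? ? z ?; lia. Qed.

Section Forms.
Variables (T V W : finType) (th : W -> V -> int) (ell : V -> nat).
Hypothesis th_inj : forall w w', th w =1 th w' -> w = w'.
Hypothesis th_range : forall w v, 1 <= th w v <= (ell v)%:Z.
Hypothesis th_surj : forall h : V -> int, (forall v, 1 <= h v <= (ell v)%:Z) ->
  exists w, th w =1 h.
Hypothesis ellH : forall v, (ell v <= H)%N.
Hypothesis ellL : forall v, H%:R / L <= (ell v)%:R.
Hypothesis VK : #|V|%:R <= K.
Hypothesis T0 : (0 < #|T|)%N.
Hypothesis TK : #|T|%:R <= K.
Variables (a : T -> int) (c : T -> V -> int).
Hypothesis aK : forall j, `|a j|%:~R <= K * N.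
Hypothesis cK : forall j v, `|c j v|%:~R <= K * B.
Hypothesis c_inj : forall j j', c j =1 c j' -> j = j'.

Definition form j (x : 'I_nn) w : int := x.+1%:Z + a j + \sum_v c j v * th w v.

(** Transport of the condition from ordinals to arbitrary index types: [T] for the forms, [V] for
    the variables, [W] for the points of the box. Here x runs over all of [N], and the sides of the
    box start at 1. *)
Lemma lfc_finite (f : T -> int -> R) : (forall j, f j = nu \/ f j = indN) ->
  `|\sum_(x < nn) \sum_w \prod_j f j (form j x w)
    - \sum_(x < nn) \sum_w \prod_j indN (form j x w)| <= eta * (nn * #|W|)%:R.
Proof.
move=> fP.
(* N < nn + 1 <= 2 nn <= L nn. *)
have NR : N / L <= nn%:R.
  have := nnN => /andP[_ N2]; have := nn0; have := L2 => L2' nn0'.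
  have L0 : 0 < L by lra.
  rewrite ler_pdivrMr //.
  have n1 : 1 <= nn%:R :> R by rewrite ler1n.
  have n2 : nn.+1%:R = nn%:R + 1 :> R by rewrite natr1.
  nra.
pose Is (t : 'I_#|V|) := [set x : int | 1 <= x <= (ell (enum_val t))%:Z].
have IsC t : Defs.card (Is t) = ell (enum_val t).
  have [||-> _] := @avg_reindex R _ 'I_(ell (enum_val t)) (Is t) (fun i => i.+1%:Z) (fun=> 0).
  - by move=> i j [] /val_inj.
  - by move=> x; rewrite /Is /= bracket_ord.
  - by rewrite card_ord.
have brE := bracket_floor nnN.
have [brI brP] : injective (fun i : 'I_nn => i.+1%:Z) /\
    forall x, bracket N x <-> exists i : 'I_nn, x = i.+1%:Z.
  by split=> [i j [] /val_inj|x] //; rewrite brE /= bracket_ord.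
have HR : (H%:R <= (H%:R : R)) && ((H%:R : R) < H.+1%:R) by rewrite lexx ltr_nat ltnS leqnn.
have [brC _] := avg_reindex (fun=> 0 : R) brI brP.
have h1 : interval_in (bracket N) (bracket N).
  by split=> //; rewrite brE; apply: is_interval_int_cc.
have h2 : N / L <= (Defs.card (bracket N))%:R by rewrite brC card_ord.
have h3 t : interval_in (bracket (H%:R : R)) (Is t).
  split; first exact: is_interval_int_cc.
  by rewrite (bracket_floor HR) /Is => x /= /andP[-> xl]; apply: le_trans xl _; rewrite lez_nat ellH.
have h4 t : H%:R / L <= (Defs.card (Is t))%:R by rewrite IsC.
pose a' (j : 'I_#|T|) := a (enum_val j).
pose c' (j : 'I_#|T|) : {ffun 'I_#|V| -> int} := [ffun t => c (enum_val j) (enum_val t)].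
have h5 j : `|a' j|%:~R <= K * N by apply: aK.
have h6 j t : `|c' j t|%:~R <= K * B by rewrite ffunE; apply: cK.
have h7 : injective c'.
  move=> i j /ffunP cij; apply: enum_val_inj; apply: c_inj => v.
  by have := cij (enum_rank v); rewrite !ffunE enum_rankK.
have h8 (j : 'I_#|T|) : f (enum_val j) = nu \/ f (enum_val j) = \1_(bracket N).
  by rewrite indic_bracket.
have := lfc VK T0 TK h1 h2 h3 h4 h5 h6 h7 h8.
pose th' (w : W) : {ffun 'I_#|V| -> int} := [ffun t => th w (enum_val t)].
have th'I : injective th'.
  move=> w w' /ffunP ww; apply: th_inj => v.
  by have := ww (enum_rank v); rewrite !ffunE enum_rankK.
have th'P h : box Is h <-> exists w, h = th' w.
  split=> [hI|[w ->] t]; last by rewrite ffunE; apply: th_range.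
  have [|w wh] := th_surj (h := fun v => h (enum_rank v)).
    by move=> v; have := hI (enum_rank v); rewrite /Is /= enum_rankK.
  by exists w; apply/ffunP => t; rewrite ffunE wh enum_valK.
have formE (x : 'I_nn) w : forall j, x.+1%:Z + a' j + \sum_(t < #|V|) c' j t * th' w t
    = form (enum_val j) x w.
  move=> j; rewrite /form (reindex (@enum_val V predT)) /=; last exact/onW_bij/enum_val_bij.
  by congr (_ + _); apply: eq_bigr => t _; rewrite !ffunE.
have avgE (g : T -> int -> R) :
    avg (bracket N) (fun x => avg (box Is) (fun h => \prod_(j < #|T|)
      g (enum_val j) (x + a' j + \sum_(t < #|V|) c' j t * h t)))
    = (\sum_(x < nn) \sum_w \prod_j g j (form j x w)) / (nn * #|W|)%:R.
  have [_ ->] := avg_reindex (fun x => avg (box Is) (fun h => \prod_(j < #|T|)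
      g (enum_val j) (x + a' j + \sum_(t < #|V|) c' j t * h t))) brI brP.
  rewrite card_ord !mulr_suml; apply: eq_bigr => x _.
  have [_ ->] := avg_reindex (fun h : {ffun 'I_#|V| -> int} => \prod_(j < #|T|)
      g (enum_val j) (x.+1%:Z + a' j + \sum_(t < #|V|) c' j t * h t)) th'I th'P.
  rewrite natrM invfM [_^-1 * _^-1]mulrC mulrA; congr (_ / _ / _); apply: eq_bigr => w _.
  rewrite [RHS](reindex (@enum_val T predT)) /=; last exact/onW_bij/enum_val_bij.
  by apply: eq_bigr => j _; rewrite formE.
rewrite indic_bracket (avgE f) (avgE (fun=> indN)) -mulrBl normrM normfV.
(* With an empty box both sums vanish; otherwise its size can be cleared from the denominators. *)
have [W0|W0] := posnP #|W|.
  move=> _; rewrite W0 muln0 mulr0 !big1 ?subrr ?normr0 //.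
    by move=> x _; rewrite big_pred0 // => w; have := fintype0 w W0.
  by move=> x _; rewrite big_pred0 // => w; have := fintype0 w W0.
have D0 : (0 : R) < (nn * #|W|)%:R by rewrite ltr0n muln_gt0 nn0.
by rewrite (ger0_norm (ltW D0)) ler_pdivrMr.
Qed.

Variables (al be : T -> R).
Hypothesis al1 : forall j, `|al j| <= 1.
Hypothesis be1 : forall j, `|be j| <= 1.

(* Every factor is a combination al * nu + be * 1_[N]; expanding the product, all terms
   share the same main term, so only the product of the al + be survives. *)
Lemma lfc_linear :
  `|\sum_(x < nn) \sum_w \prod_j (al j * nu (form j x w) + be j * indN (form j x w))
    - (\prod_j (al j + be j)) * \sum_(x < nn) \sum_w \prod_j indN (form j x w)|
  <= 2 ^+ #|T| * (eta * (nn * #|W|)%:R).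
Proof.
pose f (J : {set T}) j := if j \in J then nu else indN.
pose co (J : {set T}) := \prod_j (if j \in J then al j else be j).
have -> : \sum_(x < nn) \sum_w \prod_j (al j * nu (form j x w) + be j * indN (form j x w))
    = \sum_(J : {set T}) co J * \sum_(x < nn) \sum_w \prod_j f J j (form j x w).
  under [RHS]eq_bigr do rewrite mulr_sumr.
  rewrite [RHS]exchange_big; apply: eq_bigr => x _.
  under [RHS]eq_bigr do rewrite mulr_sumr.
  rewrite [RHS]exchange_big; apply: eq_bigr => w _.
  rewrite bigA_distr; apply: eq_bigr => J _; rewrite -big_split /=.
  by apply: eq_bigr => j _; rewrite /f; case: ifP.
rewrite bigA_distr mulr_suml -sumrB; apply: le_trans (ler_norm_sum _ _ _) _.
apply: le_trans (_ : \sum_(J : {set T}) eta * (nn * #|W|)%:R <= _); last rewrite sumr_const.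
  apply: ler_sum => J _; rewrite -mulrBr normrM -[leRHS]mul1r ler_pM //.
    by apply: norm_prod_le1 => j _; case: ifP.
  by apply: lfc_finite => j; rewrite /f; case: ifP; [left|right].
have -> : #|{: {set T}}| = (2 ^ #|T|)%N.
  by rewrite -[in RHS]cardsT -card_powerset; apply: eq_card => J; rewrite powersetE finset.subsetT.
by rewrite -natrX mulr_natl.
Qed.

Lemma sum_indN_le : `|\sum_(x < nn) \sum_w \prod_j indN (form j x w)| <= (nn * #|W|)%:R.
Proof.
apply: le_trans (ler_norm_sum _ _ _) _.
rewrite natrM mulr_natl -[X in _ <= _ *+ X]card_ord -sumr_const; apply: ler_sum => x _.
apply: le_trans (ler_norm_sum _ _ _) _.
rewrite -sumr_const; apply: ler_sum => w _.
by apply: norm_prod_le1 => j _; rewrite /indN; case: (_ <= _ <= _); rewrite ?normr1 ?normr0.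
Qed.

(** The indicator average is at most 1, which leaves the coefficient [\prod_j (al j + be j)]: at
    most 1 for majorants, and 0 as soon as one factor is nu - 1. *)
Lemma lfc_upper :
  `|\sum_(x < nn) \sum_w \prod_j (al j * nu (form j x w) + be j * indN (form j x w))|
  <= (`|\prod_j (al j + be j)| + 2 ^+ #|T| * eta) * (nn * #|W|)%:R.
Proof.
rewrite -[X in `|X|](subrK ((\prod_j (al j + be j)) *
  \sum_(x < nn) \sum_w \prod_j indN (form j x w))).
apply: le_trans (ler_normD _ _) _; rewrite mulrDl addrC lerD //.
  by rewrite normrM ler_wpM2l // sum_indN_le.
by rewrite -mulrA lfc_linear.
Qed.

End Forms.

End LinearForms.

(** * Counts with a balanced factor *)

Section CountBound.
Import mathcomp.boot.fintype mathcomp.boot.finset.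
Variables (R : realType) (K L eta N B C0 : R) (H nn : nat) (nu : int -> R).
Hypothesis lfc : linear_forms_condition K L eta N B H nu.
Hypothesis nnN : nn%:R <= N < nn.+1%:R.
Hypothesis nn0 : (0 < nn)%N.
Hypothesis H0 : (0 < H)%N.
Hypothesis BH : B * H%:R = N.
Hypothesis B1 : 1 <= B.
Hypothesis L2 : 2 <= L.
Hypothesis eta01 : 0 < eta < 1.
Hypothesis nu0 : forall x, 0 <= nu x.
Hypothesis nu_supp : forall x, ~~ (1 <= x <= nn%:Z) -> nu x = 0.
Hypothesis C01 : 1 <= C0.
Variables (I : finType) (side : I -> bool) (b : I -> int).
Hypothesis b_inj : injective b.
Hypothesis b_neq0 : forall i, b i != 0.
Hypothesis b_le : forall i, `|b i|%:~R <= C0 * B.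
Hypothesis KC : 2 * C0 <= K.
Hypothesis K2 : 2 <= K.
Hypothesis KI : #|{: unit + I}|%:R <= K.
Variables (al be : I -> R).
Hypothesis al0 : forall i, 0 <= al i.
Hypothesis be0 : forall i, 0 <= be i.
Hypothesis albe : forall i, al i + be i <= 1.

Let ind := @indN R nn.

Lemma eta_le1 : 0 <= eta <= 1.
Proof. by have := eta01 => /andP[? ?]; rewrite !ltW. Qed.

(** A combination rather than a choice between nu and 1_[N]: one statement then serves i in S, i
    outside S, and both envelopes. *)
Definition majorant i x : R := al i * nu x + be i * ind x.

Lemma al_norm i : `|al i| <= 1.
Proof. by have := al0 i; have := be0 i; have := albe i => ? ? ?; rewrite ger0_norm //; lra. Qed.

Lemma be_norm i : `|be i| <= 1.
Proof. by have := al0 i; have := be0 i; have := albe i => ? ? ?; rewrite ger0_norm //; lra. Qed.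

Lemma ind_ge0 x : 0 <= ind x.
Proof. exact: ler0n. Qed.

Lemma majorant_ge0 i x : 0 <= majorant i x.
Proof. by rewrite addr_ge0 // mulr_ge0 // ?ind_ge0. Qed.

Definition window_point (o1 o2 : nat) (i : I) (x m1 m2 : nat) : int :=
  x.+1%:Z + b i * (if side i then (m2 + o2).+1 else (m1 + o1).+1)%:Z.

(** The form x has zero coefficients, and the form of [i] has the single nonzero coefficient [b i],
    in the slot [side i]; so distinct nonzero shifts give distinct vectors. The offsets of the
    windows go into the constant terms, of size at most C0 B (2 H) = 2 C0 N. *)
Lemma pair_window_linear (l1 l2 o1 o2 : nat) (a0 b0 : R) :
  (l1 <= H)%N -> (l2 <= H)%N -> H%:R / L <= l1%:R -> H%:R / L <= l2%:R ->
  (o1 <= 2 * H)%N -> (o2 <= 2 * H)%N -> `|a0| <= 1 -> `|b0| <= 1 ->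
  `|\sum_(x < nn) \sum_(m1 < l1) \sum_(m2 < l2) (a0 * nu x.+1%:Z + b0 * ind x.+1%:Z) *
       \prod_i majorant i (window_point o1 o2 i x m1 m2)
    - (a0 + b0) * (\prod_i (al i + be i)) *
      \sum_(x < nn) \sum_(m1 < l1) \sum_(m2 < l2) \prod_i ind (window_point o1 o2 i x m1 m2)|
  <= 2 ^+ #|{: unit + I}| * eta * (nn * (l1 * l2))%:R.
Proof.
move=> l1H l2H l1L l2L o1H o2H a01 b01.
pose T := (unit + I)%type.
pose th (w : 'I_l1 * 'I_l2) (v : bool) : int := if v then w.2.+1%:Z else w.1.+1%:Z.
pose ell (v : bool) := if v then l2 else l1.
pose a (j : T) : int := if j is inr i then b i * (if side i then o2 else o1)%:Z else 0.
pose c (j : T) (v : bool) : int := if j is inr i then (if v == side i then b i else 0) else 0.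
pose al' (j : T) : R := if j is inr i then al i else a0.
pose be' (j : T) : R := if j is inr i then be i else b0.
have CB0 : 0 <= C0 * B by have := C01; have := B1 => ? ?; nra.
have KB : C0 * B <= K * B.
  by apply: ler_wpM2r; [have := B1 => ?; lra | have := KC; have := C01 => ? ?; lra].
have K0 : 0 <= K by have := K2 => ?; lra.
have eta0 : 0 <= eta by have := eta01 => /andP[? _]; lra.
have bK i : `|b i|%:~R <= K * B := le_trans (b_le i) KB.
have th_inj w w' : th w =1 th w' -> w = w'.
  case: w w' => [w1 w2] [w1' w2'] ww.
  by congr (_, _); apply: val_inj; [have := ww false|have := ww true]; rewrite /th /= => -[].
have th_range w v : 1 <= th w v <= (ell v)%:Z.
  by rewrite /th /ell; case: v; rewrite !lez_nat ltn_ord.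
have th_surj h : (forall v, 1 <= h v <= (ell v)%:Z) -> exists w, th w =1 h.
  move=> hP; have /bracket_ord[i1 h1] := hP false; have /bracket_ord[i2 h2] := hP true.
  by exists (i1, i2) => -[]; rewrite /th /= ?h1 ?h2.
have ellH v : (ell v <= H)%N by case: v.
have ellL v : H%:R / L <= (ell v)%:R by case: v.
have VK : #|{: bool}|%:R <= K by rewrite card_bool.
have T0 : (0 < #|{: T}|)%N by rewrite card_sum card_unit.
have N0 : 0 <= N by have := nnN => /andP[? _]; apply: le_trans (ler0n _ nn) _.
have aK j : `|a j|%:~R <= K * N.
  case: j => [_|i] /=; first by rewrite normr0 mulr_ge0.
  rewrite normrM rmorphM /= -BH.
  have o2' : `|(if side i then o2 else o1)%:Z|%:~R <= 2 * H%:R :> R.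
    by rewrite ger0_norm // -pmulrn -natrM ler_nat; case: ifP.
  have e1 : 0 <= `|b i|%:~R :> R by rewrite ler0z.
  have e2 : 0 <= `|(if side i then o2 else o1)%:Z|%:~R :> R by rewrite ler0z.
  apply: le_trans (ler_pM e1 e2 (b_le i) o2') _.
  have -> : C0 * B * (2 * H%:R) = 2 * C0 * (B * H%:R) by ring.
  by rewrite ler_wpM2r // BH.
have cK j v : `|c j v|%:~R <= K * B.
  have KB0 : 0 <= K * B by apply: le_trans CB0 KB.
  by case: j => [_|i] /=; rewrite ?normr0 //; case: ifP => // _; rewrite normr0.
have c_inj j j' : c j =1 c j' -> j = j'.
  case: j j' => [[]|i] [[]|i'] //= ccj.
  - by have := ccj (side i'); rewrite /c eqxx => bi; have := b_neq0 i'; rewrite -bi eqxx.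
  - by have := ccj (side i); rewrite /c eqxx => bi; have := b_neq0 i; rewrite bi eqxx.
  have := ccj (side i); rewrite /c eqxx; case: ifP => _ bi; last by have := b_neq0 i; rewrite bi eqxx.
  by rewrite (b_inj bi).
have al'1 j : `|al' j| <= 1 by case: j => [u|i]; rewrite //= al_norm.
have be'1 j : `|be' j| <= 1 by case: j => [u|i]; rewrite //= be_norm.
have := lfc_linear lfc nnN nn0 L2 K0 eta0 th_inj th_range th_surj ellH ellL VK T0 KI aK cK c_inj al'1 be'1.
rewrite card_prod !card_ord mulrA; apply: le_trans.
have formE i x m1 m2 : form th a c (inr i) x (m1, m2) = window_point o1 o2 i x m1 m2.
  rewrite /form /window_point big_bool /= /th /=; case: (side i); rewrite /= mul0r ?addr0 ?add0r -addrA -mulrDr.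
    by rewrite -PoszD addnS addnC.
  by rewrite -PoszD addnS addnC.
have formE0 x m1 m2 : form th a c (inl tt) x (m1, m2) = x.+1%:Z.
  by rewrite /form big_bool /= !mul0r !addr0.
rewrite le_eqVlt; apply/orP; left; apply/eqP; congr (`|_ - _ * _|).
- apply: eq_bigr => x _; rewrite pair_bigA /=; apply: eq_bigr => -[m1 m2] _ /=.
  rewrite big_sumType /= (big_pred1 tt) => [|[]//]; rewrite formE0.
  by congr (_ * _); apply: eq_bigr => i _; rewrite formE.
- by rewrite big_sumType /= (big_pred1 tt) => [|[]//].
- apply: eq_bigr => x _; rewrite pair_bigA /=; apply: eq_bigr => -[m1 m2] _ /=.
  rewrite big_sumType /= (big_pred1 tt) => [|[]//]; rewrite formE0.
  (* x lies in [N], so its factor in the main term is 1. *)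
  rewrite [X in _ = X * _](_ : _ = 1) ?mul1r; last by rewrite /indN /= lez_nat ltn_ord.
  by apply: eq_bigr => i _; rewrite formE.
Qed.

(** The weight nu + 1_[N] dominates |nu - 1_[N]|, so this controls every boundary strip. *)
Lemma pair_window_bound (l1 l2 o1 o2 : nat) :
  (l1 <= H)%N -> (l2 <= H)%N -> H%:R / L <= l1%:R -> H%:R / L <= l2%:R ->
  (o1 <= 2 * H)%N -> (o2 <= 2 * H)%N ->
  \sum_(x < nn) \sum_(m1 < l1) \sum_(m2 < l2) (nu x.+1%:Z + ind x.+1%:Z) *
     \prod_i majorant i (x.+1%:Z + b i * (if side i then (m2 + o2).+1 else (m1 + o1).+1)%:Z)
  <= (2 + 2 ^+ #|{: unit + I}|) * (nn * (l1 * l2))%:R.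
Proof.
move=> l1H l2H l1L l2L o1H o2H.
have n1 : `|1 : R| <= 1 by rewrite normr1.
have /ler_normlP[_] := pair_window_linear l1H l2H l1L l2L o1H o2H n1 n1.
set P1 := \prod_i _; set S1 := \sum_(x < nn) \sum_(m1 < l1) \sum_(m2 < l2) \prod_i ind _.
have P01 : 0 <= P1 <= 1.
  apply/andP; split; first by apply: prodr_ge0 => i _; rewrite addr_ge0.
  by apply: Num.Theory.prodr_ile1 => i _; rewrite addr_ge0 ?albe.
have S01 : 0 <= S1 <= (nn * (l1 * l2))%:R.
  apply/andP; split.
    by apply: sumr_ge0 => x _; apply: sumr_ge0 => m1 _; apply: sumr_ge0 => m2 _; apply: prodr_ge0 => i _.
  rewrite natrM mulr_natl -[X in _ *+ X](card_ord nn) -sumr_const; apply: ler_sum => x _.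
  rewrite natrM mulr_natl -[X in _ *+ X](card_ord l1) -sumr_const; apply: ler_sum => m1 _.
  rewrite -[l2 in X in _ <= X]card_ord -sumr_const; apply: ler_sum => m2 _.
  by apply: Num.Theory.prodr_ile1 => i _; rewrite ind_ge0 /ind /indN (ler_nat R _ 1) leq_b1.
have c0 : 0 <= 2 ^+ #|{: unit + I}| :> R by rewrite exprn_ge0.
move=> h; apply: window_upper_le P01 S01 c0 eta_le1 _.
apply: le_trans h; rewrite lerB // le_eqVlt; apply/orP; left; apply/eqP.
by apply: eq_bigr => x _; apply: eq_bigr => m1 _; apply: eq_bigr => m2 _; rewrite !mul1r.
Qed.

(** * Cubes of forms in the translation variables *)

Variables (q Tw : nat).
Hypothesis qH : (q <= H)%N.
Hypothesis qL : H%:R / L <= q%:R.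
Hypothesis KT : #|{: {set I} + I * {set I}}|%:R <= K.
Hypothesis KV : #|{: bool + I * bool}|%:R <= K.
Hypothesis KTw : Tw%:R <= K.

Local Notation m_at i m := (if side i then m.2.+1%:Z else m.1.+1%:Z).

Definition point0 (z : int) (v : {ffun I -> 'I_q}) : int := z - \sum_j b j * (v j).+1%:Z.

(** This is [point0 z v + b i * (m_at i m + y)], with y the sum of the y_j, arranged so that y_i
    visibly has coefficient 0. *)
Definition point (i : I) (z : int) (m : 'I_H * 'I_H) (v : {ffun I -> 'I_q}) : int :=
  z + b i * m_at i m + \sum_j (b i - b j) * (v j).+1%:Z.

(* [inl w] indexes the copies of nu - 1, [inr (i, w)] those of the majorant of the
   i-th factor; the latter does not involve y_i, so only w without i are kept. *)
Definition cube_point (p : {set I} + I * {set I}) (z : int) (m : 'I_H * 'I_H)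
    (u : {ffun I -> 'I_q * 'I_q}) : int :=
  match p with inl w => point0 z (sel w u) | inr (i, w) => point i z m (sel w u) end.

Definition cube_size : nat := #|{: {set I} + I * {set I}}|.

(** The m-coefficients tell copies of nu - 1 from copies of majorants and recover [i]. The slot (k,
    k \in w) then carries -b_k or b_i - b_k, which is nonzero unless k = i, and so recovers [w] away
    from [i]; at [i] itself the condition [i \notin w] decides. *)
Lemma lfc_cube (P : {pred {set I} + I * {set I}}) (al' be' : {set I} + I * {set I} -> R) (tz : int) :
  (exists p, p \in P) -> (forall i w, inr (i, w) \in P -> i \notin w) ->
  (forall p, `|al' p| <= 1) -> (forall p, `|be' p| <= 1) -> (`|tz| <= Tw%:Z) ->
  `|\sum_(x < nn) \sum_(m : 'I_H * 'I_H) \sum_(u : {ffun I -> 'I_q * 'I_q})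
      \prod_(p in P) (al' p * nu (cube_point p (x.+1%:Z + tz * nn%:Z) m u)
                    + be' p * ind (cube_point p (x.+1%:Z + tz * nn%:Z) m u))|
  <= (`|\prod_(p in P) (al' p + be' p)| + 2 ^+ cube_size * eta)
     * (nn * #|{: ('I_H * 'I_H) * {ffun I -> 'I_q * 'I_q}}|)%:R.
Proof.
move=> [p0 p0P] Pi al1 be1 tzT.
pose T := {p | p \in P}.
pose V := (bool + I * bool)%type.
pose W := (('I_H * 'I_H) * {ffun I -> 'I_q * 'I_q})%type.
pose th (w : W) (v : V) : int := match v with
  | inl s => if s then w.1.2.+1%:Z else w.1.1.+1%:Z
  | inr (j, s) => if s then (w.2 j).2.+1%:Z else (w.2 j).1.+1%:Z end.
pose ell (v : V) := if v is inl _ then H else q.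
pose a (j : T) : int := tz * nn%:Z.
pose c (p : T) (v : V) : int := match val p, v with
  | inl w, inl _ => 0
  | inl w, inr (j, s) => if s == (j \in w) then - b j else 0
  | inr (i, w), inl s => if s == side i then b i else 0
  | inr (i, w), inr (j, s) => if s == (j \in w) then b i - b j else 0 end.
have CB0 : 0 <= C0 * B by have := C01; have := B1 => ? ?; nra.
have K0 : 0 <= K by have := K2 => ?; lra.
have eta0 : 0 <= eta by have := eta01 => /andP[? _]; lra.
have KB : 2 * (C0 * B) <= K * B.
  by rewrite mulrA; apply: ler_wpM2r => //; have := B1 => ?; lra.
have th_inj w w' : th w =1 th w' -> w = w'.
  case: w w' => [[w1 w2] w3] [[w1' w2'] w3'] ww.
  have [e1] := ww (inl false); have [e2] := ww (inl true).
  congr (_, _); first by congr (_, _); apply: val_inj.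
  apply/ffunP => j; have [] := ww (inr (j, false)); have [] := ww (inr (j, true)).
  rewrite /= [w3 j]surjective_pairing [w3' j]surjective_pairing => e3 e4.
  by congr (_, _); apply: val_inj.
have th_range w v : 1 <= th w v <= (ell v)%:Z.
  by rewrite /th /ell; case: v => [[]|[j []]]; rewrite !lez_nat ltn_ord.
have th_surj h : (forall v, 1 <= h v <= (ell v)%:Z) -> exists w, th w =1 h.
  move=> hP; have /bracket_ord[i1 h1] := hP (inl false); have /bracket_ord[i2 h2] := hP (inl true).
  have {}hP j s : exists i : 'I_q, h (inr (j, s)) = i.+1%:Z.
    by apply/bracket_ord; apply: hP.
  have [f fP] := choice (fun js : I * bool => hP js.1 js.2).
  exists ((i1, i2), [ffun j => (f (j, false), f (j, true))]).
  by case=> [[]|[j []]]; rewrite /th /= ?h1 ?h2 // ffunE /= -(fP (_, _)).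
have ellH v : (ell v <= H)%N by case: v.
have ellL v : H%:R / L <= (ell v)%:R.
  case: v => [s|js] //=; have L0 : 0 < L by have := L2 => ?; lra.
  by rewrite ler_pdivrMr // ler_peMr //; have := L2 => ?; lra.
have T0 : (0 < #|{: T}|)%N by apply/card_gt0P; exists (Sub p0 p0P).
have TK' : (#|{: T}| <= cube_size)%N by rewrite card_sig max_card.
have TK : #|{: T}|%:R <= K by apply: le_trans KT; rewrite ler_nat.
have N0 : 0 <= N by have := nnN => /andP[? _]; apply: le_trans (ler0n _ nn) _.
have aK j : `|a j|%:~R <= K * N.
  rewrite /a normrM rmorphM /= ler_pM ?ler0z //.
    by apply: le_trans KTw; rewrite -(ler_int R) in tzT.
  by have := nnN => /andP[? _].
have cK j v : `|c j v|%:~R <= K * B.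
  have KB0 : 0 <= K * B by apply: le_trans KB; rewrite mulr_ge0.
  have KB1 : C0 * B <= K * B by apply: le_trans KB; lra.
  rewrite /c; case: (val j) v => [w|[i w]] [s|[k s]] /=; rewrite ?normr0 //; case: ifP => // _;
    rewrite ?normr0 // ?normrN ?(le_trans (b_le _) KB1) //.
  apply: le_trans KB; rewrite mulr_natl mulr2n.
  apply: le_trans (lerD (b_le i) (b_le k)); rewrite -rmorphD ler_int /=.
  exact: ler_normB.
have c_inj j j' : c j =1 c j' -> j = j'.
  case: j j' => [[w|[i w]] pP] [[w'|[i' w']] pP'] ccj; apply: val_inj => /=.
  - congr inl; apply/setP => k; have := ccj (inr (k, k \in w)); rewrite /c /= eqxx.
    case: eqP => // _ /eqP; rewrite oppr_eq0 => bk; by have := b_neq0 k; rewrite bk.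
  - by have := ccj (inl (side i')); rewrite /c /= eqxx => bi; have := b_neq0 i'; rewrite -bi eqxx.
  - by have := ccj (inl (side i)); rewrite /c /= eqxx => bi; have := b_neq0 i; rewrite bi eqxx.
  have ii : i = i'.
    have := ccj (inl (side i)); rewrite /c /= eqxx; case: ifP => _ bi; first exact: b_inj.
    by have := b_neq0 i; rewrite bi eqxx.
  congr inr; rewrite -ii in pP' ccj *; congr (_, _); apply/setP => k.
  have [->|ki] := eqVneq k i; first by rewrite (negbTE (Pi _ _ pP)) (negbTE (Pi _ _ pP')).
  have := ccj (inr (k, k \in w)); rewrite /c /= eqxx.
  case: eqP => // _ /eqP; rewrite subr_eq0 => /eqP /b_inj ik.
  by rewrite ik eqxx in ki.
have al1' (j : T) : `|al' (val j)| <= 1 by apply: al1.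
have be1' (j : T) : `|be' (val j)| <= 1 by apply: be1.
have := lfc_upper lfc nnN nn0 L2 K0 eta0 th_inj th_range th_surj ellH ellL KV T0 TK aK cK c_inj al1' be1'.
have formE x m u (p : T) : form th a c p x (m, u) = cube_point (val p) (x.+1%:Z + tz * nn%:Z) m u.
  rewrite /form big_sumType big_bool.
  rewrite [X in _ + (_ + X)](eq_bigr (fun js => c p (inr (js.1, js.2)) * th (m, u) (inr (js.1, js.2))));
    last by case.
  rewrite -(pair_bigA _ (fun j s => c p (inr (j, s)) * th (m, u) (inr (j, s)))) /cube_point /c /a /=.
  case: (val p) => [w|[i w]].
    rewrite !mul0r !add0r /point0 -sumrN; congr (_ + _); apply: eq_bigr => j _.
    by rewrite big_bool /= ffunE; case: (j \in w) => /=; rewrite mul0r ?addr0 ?add0r mulNr.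
  rewrite /point addrA; congr (_ + _ + _).
    by case: (side i); rewrite /= mul0r ?addr0 ?add0r.
  apply: eq_bigr => j _.
  by rewrite big_bool /= ffunE; case: (j \in w) => /=; rewrite mul0r ?addr0 ?add0r.
move=> upper; apply: le_trans (le_trans _ upper) _.
  rewrite le_eqVlt; apply/orP; left; apply/eqP; congr (`|_|); apply: eq_bigr => x _.
  rewrite pair_bigA /=; apply: eq_bigr => -[m u] _.
  rewrite big_sub /=; apply: eq_bigr => j _.
  by rewrite -formE.
by rewrite ler_wpM2r // [in leRHS]big_sub lerD2l ler_wpM2r // ler_weXn2l // ler1n.
Qed.

Variable G : I -> int -> R.
Hypothesis G_le : forall i x, `|G i x| <= majorant i x.

Let balanced x := nu x - ind x.
(* The 2 Tw + 1 translates of [N] contain every point x + sum_j b_j y_j. *)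
Let X := ('I_(2 * Tw).+1 * 'I_nn * ('I_H * 'I_H))%type.
Let base (y : X) : int := y.1.2.+1%:Z + (y.1.1%:Z - Tw%:Z) * nn%:Z.
Let nX : nat := (nn * #|{: ('I_H * 'I_H) * {ffun I -> 'I_q * 'I_q}}|)%N.
Let FF (y : X) v := balanced (point0 (base y) v).
Let GG i (y : X) v := G i (point i (base y) y.2 v).
Let VV i (y : X) v := majorant i (point i (base y) y.2 v).

Lemma point_upd i z m v p : point i z m (upd v i p) = point i z m v.
Proof.
congr (_ + _); apply: eq_bigr => j _.
by have [->|ji] := eqVneq j i; [rewrite subrr !mul0r|rewrite upd_neq].
Qed.

Lemma sum_base (f : int -> 'I_H * 'I_H -> R) (c : R) :
  (forall tz : int, `|tz| <= Tw%:Z ->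
     `|\sum_(x < nn) \sum_m f (x.+1%:Z + tz * nn%:Z) m| <= c) ->
  `|\sum_(y : X) f (base y) y.2| <= (2 * Tw).+1%:R * c.
Proof.
move=> fc; rewrite -(pair_bigA _ (fun (p : 'I_(2 * Tw).+1 * 'I_nn) m => f (p.2.+1%:Z + (p.1%:Z - Tw%:Z) * nn%:Z) m)) /=.
rewrite -(pair_bigA _ (fun (t : 'I_(2 * Tw).+1) (x : 'I_nn) =>
   \sum_m f (x.+1%:Z + (t%:Z - Tw%:Z) * nn%:Z) m)) /=.
apply: le_trans (ler_norm_sum _ _ _) _.
rewrite mulr_natl -[X in _ <= _ *+ X]card_ord -sumr_const; apply: ler_sum => t _.
exact/fc/centered_index.
Qed.

Let al' (p : {set I} + I * {set I}) : R := if p is inr (i, _) then al i else 1.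
Let be' (p : {set I} + I * {set I}) : R := if p is inr (i, _) then be i else -1.

Lemma al'_norm p : `|al' p| <= 1.
Proof. by case: p => [w|[i w]]; rewrite /= ?normr1 // al_norm. Qed.

Lemma be'_norm p : `|be' p| <= 1.
Proof. by case: p => [w|[i w]]; rewrite /= ?normrN1 // be_norm. Qed.

(** This supplies the hypothesis on the [V i] in [box_cauchy_schwarz]; the normaliser contains 2 ^
    cube_size because 1 + 2 ^ cube_size * eta <= 2 * 2 ^ cube_size. *)
Lemma sum_majorant_cube (E : {set I}) i : i \notin E ->
  \sum_(y : X) \sum_u cube_prod E (VV i y) u
  <= 2 * (2 ^+ cube_size * ((2 * Tw).+1%:R * nX%:R)).
Proof.
move=> iE.
pose P : {pred {set I} + I * {set I}} :=
  fun p => if p is inr (i', w) then (i' == i) && (w \subset E) else false.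
have prodP (g : {set I} + I * {set I} -> R) :
    \prod_(p in P) g p = \prod_(w : {set I} | w \subset E) g (inr (i, w)).
  rewrite big_sumType /= big_pred0_eq mul1r.
  rewrite (eq_big (P1 := fun p => inr p \in P) (fun p => (p.1 == i) && (p.2 \subset E))
    (fun p => g (inr (p.1, p.2)))); [|by case|by case].
  by rewrite -(pair_big_dep (pred1 i) (fun _ (w : {set I}) => w \subset E) (fun i w => g (inr (i, w)))) big_pred1_eq.
have PP : exists p, p \in P by exists (inr (i, set0)); rewrite unfold_in /= eqxx sub0set.
have Pi j w : inr (j, w) \in P -> j \notin w.
  by move=> /andP[/eqP-> wE]; apply: contra iE; apply: (subsetP wE).
apply: le_trans (ler_norm _) _.
apply: le_trans (@sum_base (fun z m => \sum_u cube_prod E (fun v => majorant i (point i z m v)) u)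
  ((1 + 2 ^+ cube_size * eta) * nX%:R) _) _.
  move=> tz tzT; apply: le_trans (le_trans _ (lfc_cube PP Pi al'_norm be'_norm tzT)) _.
    rewrite le_eqVlt; apply/orP; left; apply/eqP; congr (`|_|).
    apply: eq_bigr => x _; apply: eq_bigr => m _; apply: eq_bigr => u _.
    by rewrite prodP.
  apply: ler_wpM2r => //; rewrite lerD2r prodP.
  by apply: norm_prod_le1 => w _ /=; rewrite ger0_norm ?addr_ge0.
have -> : 2 * (2 ^+ cube_size * ((2 * Tw).+1%:R * nX%:R)) =
    (2 * Tw).+1%:R * (2 * 2 ^+ cube_size * nX%:R) :> R.
  by move: (2 ^+ cube_size : R) ((2 * Tw).+1%:R : R) (nX%:R : R) => x y z; ring.
rewrite ler_wpM2l // ler_wpM2r //.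
by apply: one_add_le_double eta_le1; rewrite exprn_ege1 // ler1n.
Qed.

(** The coefficients 1 and -1 of a factor nu - 1 add up to 0, so the main term disappears and only
    the error of the linear forms condition is left. *)
Lemma partial_form_full :
  `|partial_form FF GG VV [set: I]| <= (2 * Tw).+1%:R * (2 ^+ cube_size * eta * nX%:R).
Proof.
pose P : {pred {set I} + I * {set I}} :=
  fun p => if p is inr (i, w) then i \notin w else true.
have prodP (g : {set I} + I * {set I} -> R) :
    \prod_(p in P) g p = \prod_w g (inl w) * \prod_i \prod_(w : {set I} | i \notin w) g (inr (i, w)).
  rewrite big_sumType; congr (_ * _).
  rewrite (eq_big (P1 := fun p => inr p \in P) (fun p => true && (p.1 \notin p.2))
    (fun p => g (inr (p.1, p.2)))); [|by case|by case].
  by rewrite -(pair_big_dep xpredT (fun i (w : {set I}) => i \notin w) (fun i w => g (inr (i, w)))).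
have PP : exists p, p \in P by exists (inl set0).
have Pi j w : inr (j, w) \in P -> j \notin w by [].
rewrite /partial_form.
apply: le_trans (@sum_base (fun z m => \sum_u cube_prod setT (fun v => balanced (point0 z v)) u
  * \prod_(i : I) cube_prod (setT :\ i) (fun v => majorant i (point i z m v)) u) _ _).
  rewrite le_eqVlt; apply/orP; left; apply/eqP; congr (`|_|).
  apply: eq_bigr => y _; apply: eq_bigr => u _; rewrite big_pred0 ?mulr1; last by move=> j; rewrite inE.
  by congr (_ * _); apply: eq_bigl => j; rewrite inE.
move=> tz tzT; apply: le_trans (le_trans _ (lfc_cube PP Pi al'_norm be'_norm tzT)) _.
  rewrite le_eqVlt; apply/orP; left; apply/eqP; congr (`|_|).
  apply: eq_bigr => x _; apply: eq_bigr => m _; apply: eq_bigr => u _.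
  rewrite prodP; congr (_ * _).
    by apply: eq_big => [w|w _]; rewrite ?subsetT //= mul1r mulN1r.
  apply: eq_bigr => i _; apply: eq_bigl => w.
  by rewrite subsetD1 subsetT.
rewrite prodP (bigD1 (P := xpredT) set0) //= subrr !mul0r normr0 add0r.
exact: lexx.
Qed.

Hypothesis q0 : (0 < q)%N.

(** The root of order 2 ^ #|I| in [box_cauchy_schwarz] is where eta acquires its exponent c. *)
Lemma partial_form_empty :
  `|partial_form FF GG VV (set0 : {set I})|
  <= 2 * (2 ^+ cube_size * ((2 * Tw).+1%:R * nX%:R)) * eta `^ (2 ^+ #|I|)^-1.
Proof.
have nX0 : (0 < nX)%N.
  by rewrite muln_gt0 nn0 card_prod card_prod !card_ord !muln_gt0 H0 /= card_ffun card_prod card_ord expn_gt0 muln_gt0 q0.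
pose D : R := 2 ^+ cube_size * ((2 * Tw).+1%:R * nX%:R).
have D0 : 0 < D by rewrite !mulr_gt0 ?exprn_gt0 ?ltr0n.
have Gi i y : indep (GG i y) i by move=> v p; rewrite /GG point_upd.
have Vi i y : indep (VV i y) i by move=> v p; rewrite /VV point_upd.
have GV i y v : `|GG i y v| <= VV i y v by apply: G_le.
have Y0 : (0 < #|{: 'I_q}|)%N by rewrite card_ord.
have := box_cauchy_schwarz FF Gi Vi GV Y0 D0 sum_majorant_cube.
have [e0 e1] := andP eta_le1.
have fullD : `|partial_form FF GG VV [set: I] / D| <= eta.
  rewrite normrM normfV (gtr0_norm D0) ler_pdivrMr //.
  apply: le_trans partial_form_full _; rewrite le_eqVlt; apply/orP; left; apply/eqP; rewrite /D.
  by move: (2 ^+ cube_size : R) ((2 * Tw).+1%:R : R) (nX%:R : R) => x y w; ring.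
move=> bcs; rewrite -/D mulrAC -ler_pdivrMr //.
rewrite -[X in _ / X](gtr0_norm D0) -normfV -normrM.
set z := `|_ / _| in bcs *.
apply: root_le_powR => //; first exact: normr_ge0.
by apply: le_trans bcs _; rewrite ler_wpM2l ?exprn_ge0.
Qed.

(** * Translation of m and m', and the bound for one pair of shift vectors *)

Definition slice (m1 m2 : nat) : R := \sum_(x < nn) balanced x.+1%:Z *
  \prod_i G i (x.+1%:Z + b i * (if side i then m2.+1 else m1.+1)%:Z).

Definition pair_const : R := 2 + 2 ^+ #|{: unit + I}|.

(** Strips shorter than H/L are out of reach of the linear forms condition; passing to nonnegative
    majorants lets them be widened to admissible windows. *)
Lemma slice_window (a1 a2 l1 l2 o1 o2 : nat) : (a1 <= l1)%N -> (a2 <= l2)%N ->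
  (l1 <= H)%N -> (l2 <= H)%N -> H%:R / L <= l1%:R -> H%:R / L <= l2%:R ->
  (o1 <= 2 * H)%N -> (o2 <= 2 * H)%N ->
  `|\sum_(m1 < a1) \sum_(m2 < a2) slice (m1 + o1) (m2 + o2)| <= pair_const * (nn * (l1 * l2))%:R.
Proof.
move=> al1 al2 l1H l2H l1L l2L o1H o2H.
apply: le_trans (pair_window_bound l1H l2H l1L l2L o1H o2H).
rewrite (eq_bigr (fun m1 : 'I_a1 => \sum_(x < nn) \sum_(m2 < a2) balanced x.+1%:Z *
  \prod_i G i (x.+1%:Z + b i * (if side i then (m2 + o2).+1 else (m1 + o1).+1)%:Z))); last first.
  by move=> m1 _; rewrite exchange_big.
rewrite exchange_big; apply: le_trans (ler_norm_sum _ _ _) _; apply: ler_sum => x _.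
pose g m1 m2 := (nu x.+1%:Z + ind x.+1%:Z) *
  \prod_i majorant i (x.+1%:Z + b i * (if side i then (m2 + o2).+1 else (m1 + o1).+1)%:Z).
have g0 m1 m2 : 0 <= g m1 m2.
  by rewrite mulr_ge0 ?addr_ge0 ?ind_ge0 // prodr_ge0 // => i _; apply: majorant_ge0.
rewrite -/(g _ _); apply: le_trans (_ : \sum_(m1 < a1) \sum_(m2 < a2) g m1 m2 <= _).
  apply: le_trans (ler_norm_sum _ _ _) _; apply: ler_sum => m1 _.
  apply: le_trans (ler_norm_sum _ _ _) _; apply: ler_sum => m2 _.
  rewrite normrM ler_pM //.
    by apply: le_trans (ler_normB _ _) _; rewrite !ger0_norm ?ind_ge0.
  by rewrite normr_prod; apply: ler_prod => i _; rewrite normr_ge0 G_le.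
apply: le_trans (_ : \sum_(m1 < a1) \sum_(m2 < l2) g m1 m2 <= _).
  by apply: ler_sum => m1 _; apply: ler_sum_ord_widen.
by apply: (@ler_sum_ord_widen _ _ _ (fun m1 => \sum_(m2 < l2) g m1 m2)) => // m1; apply: sumr_ge0.
Qed.

(** m1 is translated before m2, and each translation leaves two strips of width [y], one at either
    end. They are widened to [l], for which the lower bound H/L is available. *)
Lemma slice_shift (y l : nat) : (y <= l)%N -> (l <= H)%N -> H%:R / L <= l%:R ->
  `|\sum_(m1 < H) \sum_(m2 < H) slice m1 m2
    - \sum_(m1 < H) \sum_(m2 < H) slice (m1 + y) (m2 + y)|
  <= 4 * (pair_const * (nn * (l * H))%:R).
Proof.
move=> yl lH lL.
have L1 : 1 <= L by apply: le_trans L2; rewrite ler1n.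
have HL : H%:R / L <= H%:R by rewrite ler_pdivrMr ?(lt_le_trans _ L1) // ler_peMr.
have yH := leq_trans yl lH.
have y2H : (y <= 2 * H)%N by apply: leq_trans yH _; rewrite leq_pmull.
have H2H : (H <= 2 * H)%N by rewrite leq_pmull.
have e0 (f : nat -> nat -> R) a1 a2 : \sum_(m1 < a1) \sum_(m2 < a2) f m1 m2 =
   \sum_(m1 < a1) \sum_(m2 < a2) f (m1 + 0)%N (m2 + 0)%N.
  by apply: eq_bigr => i _; apply: eq_bigr => j _; rewrite !addn0.
have e1 : \sum_(m1 < H) \sum_(m2 < H) slice m1 m2 -
    \sum_(m1 < H) \sum_(m2 < H) slice (m1 + y) m2 =
    \sum_(m1 < y) \sum_(m2 < H) slice (m1 + 0) (m2 + 0) -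
    \sum_(m1 < y) \sum_(m2 < H) slice (m1 + H) (m2 + 0).
  rewrite (sum_shift _ _ (fun m1 => \sum_(m2 < H) slice m1 m2)) -(e0 slice).
  by congr (_ - _); apply: eq_bigr => m1 _; apply: eq_bigr => m2 _; rewrite addn0.
have e2 : \sum_(m1 < H) \sum_(m2 < H) slice (m1 + y) m2 -
    \sum_(m1 < H) \sum_(m2 < H) slice (m1 + y) (m2 + y) =
    \sum_(m1 < H) \sum_(m2 < y) slice (m1 + y) (m2 + 0) -
    \sum_(m1 < H) \sum_(m2 < y) slice (m1 + y) (m2 + H).
  rewrite -!sumrB; apply: eq_bigr => m1 _.
  by rewrite sum_shift; under [X in _ = X - _]eq_bigr do rewrite addn0.
have w1 := slice_window yl (leqnn H) lH (leqnn H) lL HL (leq0n _) (leq0n _).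
have w2 := slice_window yl (leqnn H) lH (leqnn H) lL HL H2H (leq0n _).
have w3 := slice_window (leqnn H) yl (leqnn H) lH HL lL y2H (leq0n _).
have w4 := slice_window (leqnn H) yl (leqnn H) lH HL lL y2H H2H.
rewrite -[X in `|X|](subrKA (\sum_(m1 < H) \sum_(m2 < H) slice (m1 + y) m2)) e1 e2.
rewrite [(H * l)%N]mulnC in w3 w4.
apply: norm_sub4_le w1 w2 w3 w4.
Qed.

(** The translation of x is absorbed by [sum_window], as the balanced factor vanishes off [N]; only
    the translation of m1 and m2 by [y] remains. *)
Lemma sum_point_slice (v : {ffun I -> 'I_q}) (y : nat) :
  y = (\sum_j (v j).+1)%N -> `|\sum_j b j * (v j).+1%:Z| <= Tw%:Z * nn%:Z ->
  \sum_(z : X) FF z v * \prod_i GG i z v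
  = \sum_(m1 < H) \sum_(m2 < H) slice (m1 + y) (m2 + y).
Proof.
move=> yE sT; set s := \sum_j _ in sT.
pose h (m : 'I_H * 'I_H) z := balanced z * \prod_i G i (z + b i * (m_at i m + y%:Z)).
have fE (z : X) : FF z v * \prod_i GG i z v = h z.2 (base z - s).
  rewrite /FF /h /point0 -/s; congr (_ * _); apply: eq_bigr => i _; congr (G i _).
  rewrite /point yE PoszD_sum mulrDr mulr_sumr /s.
  rewrite (eq_bigr (fun j => b i * (v j).+1%:Z - b j * (v j).+1%:Z)); last first.
    by move=> j _; rewrite mulrBl.
  by rewrite sumrB; ring.
rewrite (eq_bigr _ (fun z _ => fE z)).
rewrite -(pair_bigA _ (fun (p : 'I_(2 * Tw).+1 * 'I_nn) m => h m (p.2.+1%:Z + (p.1%:Z - Tw%:Z) * nn%:Z - s))) /=.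
rewrite exchange_big [RHS]pair_bigA /=; apply: eq_bigr => m _.
rewrite -(pair_bigA _ (fun (t : 'I_(2 * Tw).+1) (x : 'I_nn) => h m (x.+1%:Z + (t%:Z - Tw%:Z) * nn%:Z - s))) /=.
rewrite sum_window //; last first.
  by move=> z zn; rewrite /h /balanced nu_supp // /ind /indN (negbTE zn) subrr mul0r.
apply: eq_bigr => x _; congr (_ * _); apply: eq_bigr => i _; congr (G i (_ + _ * _)).
by case: (side i); rewrite -PoszD addSn.
Qed.

Hypothesis I0 : (0 < #|I|)%N.
Hypothesis q_le : q%:R <= H%:R / L + 1.
Hypothesis Tw_ge : 2 * (#|I|%:R * C0) <= Tw%:R.

(** Each term is at most C0 B H = C0 N <= 2 C0 nn, since y_j <= q <= H. *)
Lemma shift_vector_bound (v : {ffun I -> 'I_q}) : `|\sum_j b j * (v j).+1%:Z| <= Tw%:Z * nn%:Z.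
Proof.
rewrite -(ler_int R) rmorphM /= -(pmulrn 1 Tw) -(pmulrn 1 nn).
have bH j : `|b j * (v j).+1%:Z|%:~R <= C0 * N.
  rewrite normrM rmorphM /= -BH mulrA ler_pM ?ler0z // (ger0_norm (x := (v j).+1%:Z)) // -(pmulrn 1 (v j).+1) ler_nat.
  exact: leq_trans (ltn_ord _) qH.
apply: le_trans (_ : \sum_(j : I) C0 * N <= _).
  apply: le_trans (_ : (\sum_j `|b j * (v j).+1%:Z|)%:~R <= _); first by rewrite ler_int ler_norm_sum.
  by rewrite rmorph_sum /=; apply: ler_sum => j _.
rewrite sumr_const -mulr_natl mulrA.
have N2 : N <= 2 * nn%:R.
  have := nnN => /andP[_ /ltW Nn]; apply: le_trans Nn _.
  by rewrite -natrM ler_nat mul2n -addnn -addn1 leq_add2l.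
have nC : 0 <= #|I|%:R * C0 by rewrite mulr_ge0 // (le_trans _ C01).
apply: le_trans (ler_wpM2l nC N2) _.
by rewrite mulrCA mulrA ler_wpM2r.
Qed.

Lemma sel_offset_le (v : {ffun I -> 'I_q}) : (\sum_j (v j).+1 <= #|I| * q)%N.
Proof. by rewrite -sum_nat_const; apply: leq_sum => j _; apply: ltn_ord. Qed.

Definition count_const : R := 2 * (2 ^+ cube_size * (2 * Tw).+1%:R) + 4 * pair_const * #|I|%:R.

(** The count is compared with the average of its translates over all shift vectors, which is
    [partial_form] at the empty set up to normalisation. The relative boundary cost is of order #|I|
    q / H, where q / H <= L^-1 + H^-1. *)
Lemma slice_count_bound :
  `|\sum_(m1 < H) \sum_(m2 < H) slice m1 m2|
  <= count_const * (nn * (H * H))%:R * (eta `^ (2 ^+ #|I|)^-1 + (L^-1 + H%:R^-1)).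
Proof.
set S := \sum_(m1 < H) _; set ec := eta `^ _; set dl := L^-1 + _.
have ec0 : 0 <= ec by apply: powR_ge0.
have HR0 : (0 : R) < H%:R by rewrite ltr0n.
have L1 : 1 <= L by apply: le_trans L2; rewrite ler1n.
have HL : H%:R / L <= H%:R by rewrite ler_pdivrMr ?(lt_le_trans _ L1) // ler_peMr.
have pc0 : 0 <= pair_const by rewrite addr_ge0 ?exprn_ge0.
have dl0 : 0 <= dl by rewrite addr_ge0 // invr_ge0 ?ltW // (lt_le_trans _ L1).
have qd : q%:R <= H%:R * dl by rewrite mulrDr mulfV ?gt_eqF.
have a0 : 0 <= 2 * (2 ^+ cube_size * (2 * Tw).+1%:R) :> R by rewrite !mulr_ge0 ?exprn_ge0.
have b0 : 0 <= 4 * pair_const * #|I|%:R by rewrite !mulr_ge0.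
have M0 : 0 <= (nn * (H * H))%:R :> R by [].
(* If the total translation can exceed H, the error term is bounded below and the trivial bound
   suffices. *)
have [lH|lH] := leqP (#|I| * q)%N H; last first.
  have nd : 1 <= #|I|%:R * dl.
    rewrite -(ler_pM2l HR0) mulr1 mulrCA; apply: le_trans (ler_wpM2l _ qd) => //.
    by rewrite -natrM ler_nat ltnW.
  have := slice_window (leqnn H) (leqnn H) (leqnn H) (leqnn H) HL HL (leq0n _) (leq0n _).
  have -> : \sum_(m1 < H) \sum_(m2 < H) slice (m1 + 0) (m2 + 0) = S.
    by apply: eq_bigr => i _; apply: eq_bigr => j _; rewrite !addn0.
  move=> Sle; apply: le_trans Sle _; rewrite /count_const.
  by apply: short_range_le.
have lL : H%:R / L <= (#|I| * q)%:R.
  by apply: le_trans qL _; rewrite ler_nat leq_pmull.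
pose cU := #|{ffun I -> 'I_q * 'I_q}|.
have cU0 : (0 < cU)%N by rewrite /cU card_ffun card_prod card_ord expn_gt0 muln_gt0 q0.
have cUR : (0 : R) < cU%:R by rewrite ltr0n.
(* At the empty set every cube has the single vertex [set0], which reads first components. *)
have pfE : partial_form FF GG VV (set0 : {set I}) =
    \sum_(u : {ffun I -> 'I_q * 'I_q}) \sum_(z : X) FF z (sel set0 u) * \prod_i GG i z (sel set0 u).
  rewrite /partial_form exchange_big; apply: eq_bigr => u _; apply: eq_bigr => z _.
  have cube0 phi : cube_prod set0 phi u = phi (sel set0 u).
    by rewrite /cube_prod (eq_bigl (pred1 set0)) ?big_pred1_eq // => w; rewrite subset0.
  rewrite cube0 [X in _ * X]big_pred0 ?mulr1; last by move=> j; rewrite inE.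
  by congr (_ * _); apply: eq_big => [j|j _]; rewrite ?inE ?cube0.
have key : `|cU%:R * S - partial_form FF GG VV (set0 : {set I})|
    <= cU%:R * (4 * (pair_const * (nn * (#|I| * q * H))%:R)).
  rewrite pfE mulr_natl -sumr_const -sumrB mulr_natl -[leRHS]sumr_const.
  apply: le_trans (ler_norm_sum _ _ _) _; apply: ler_sum => u _.
  rewrite (sum_point_slice (erefl _) (shift_vector_bound _)).
  exact: slice_shift (sel_offset_le _) lH lL.
have pfe := partial_form_empty.
have nXE : (nX%:R : R) = (nn * (H * H))%:R * cU%:R.
  by rewrite /nX card_prod card_prod !card_ord -natrM mulnA.
rewrite nXE in pfe; rewrite -(ler_pM2l cUR) /count_const.
rewrite -[X in X * `|S|](gtr0_norm cUR) -normrM.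
have qd' : (nn * (#|I| * q * H))%:R <= (nn * (H * H))%:R * (#|I|%:R * dl) :> R.
  have -> : (nn * (H * H))%:R * (#|I|%:R * dl) = (nn * (#|I| * H))%:R * (H%:R * dl) :> R.
    by rewrite !natrM; ring.
  have -> : (nn * (#|I| * q * H) = nn * (#|I| * H) * q)%N by ring.
  by rewrite natrM ler_wpM2l.
by apply: shifted_count_le key pfe _ _ _ _ _ _ _ qd' => //; apply: ltW.
Qed.

End CountBound.

(** * Complex weights *)

Section ComplexModulus.
Variable R : realType.
Implicit Types (z : R[i]) (x : R).

Lemma cmodE z : (cmod z)%:C = `|z|.
Proof. by []. Qed.

Lemma cmod_ge0 z : 0 <= cmod z.
Proof. by rewrite -lecR cmodE; apply: normr_ge0. Qed.

Lemma cmod0 : cmod (0 : R[i]) = 0.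
Proof. exact: ComplexField.Normc.normc0. Qed.

Lemma cmodM z w : cmod (z * w) = cmod z * cmod w.
Proof. exact: ComplexField.Normc.normcM. Qed.

Lemma cmod_real x : cmod x%:C = `|x|.
Proof. by apply: complexI; rewrite cmodE normc_def /= expr0n addr0 sqrtr_sqr. Qed.

Lemma cmod_conj z : cmod (conjc z) = cmod z.
Proof. by apply: complexI; rewrite !cmodE normcJ. Qed.

Lemma cmod_sum (T : finType) (f : T -> R[i]) : cmod (\sum_t f t) <= \sum_t cmod (f t).
Proof.
rewrite -lecR cmodE rmorph_sum /=.
exact: ler_norm_sum.
Qed.

Lemma cmod_prod (T : finType) (f : T -> R[i]) : cmod (\prod_t f t) = \prod_t cmod (f t).
Proof. by apply: complexI; rewrite cmodE rmorph_prod /= normr_prod. Qed.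

Lemma conjcM z1 z2 : conjc (z1 * z2) = conjc z1 * conjc z2.
Proof. exact: (rmorphM (@conjc R)). Qed.

Lemma conjc_sum (T : finType) (f : T -> R[i]) : conjc (\sum_t f t) = \sum_t conjc (f t).
Proof. exact: (rmorph_sum (@conjc R)). Qed.

Lemma conjc_prod (T : finType) (f : T -> R[i]) : conjc (\prod_t f t) = \prod_t conjc (f t).
Proof. exact: (rmorph_prod (@conjc R)). Qed.

Lemma cmod_sqr z : (cmod z ^+ 2)%:C = z * conjc z.
Proof. by rewrite rmorphXn /= cmodE sqr_normc. Qed.

Lemma Re_le_cmod z : `|complex.Re z| <= cmod z.
Proof. by rewrite -lecR cmodE normc_ge_Re. Qed.

Lemma Im_le_cmod z : `|complex.Im z| <= cmod z.
Proof.
case: z => a b /=; rewrite /cmod /= -sqrtr_sqr ler_wsqrtr //.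
by rewrite lerDr sqr_ge0.
Qed.

Lemma cmod_i : cmod ('i%C : R[i]) = 1.
Proof. by rewrite /cmod /= expr0n expr1n add0r sqrtr1. Qed.

End ComplexModulus.

Section ComplexCount.
Variables (R : realType) (nn H : nat) (nu : int -> R) (I : finType).
Variables (side : I -> bool) (b : I -> int) (al be : I -> R) (c : R).
Hypothesis real_bound : forall G : I -> int -> R,
  (forall i x, `|G i x| <= majorant nn nu al be i x) ->
  `|\sum_(m1 < H) \sum_(m2 < H) slice nn nu side b G m1 m2| <= c.

Definition complex_slice (g : I -> int -> R[i]) (m1 m2 : nat) : R[i] :=
  \sum_(x < nn) (nu x.+1%:Z - indN R nn x.+1%:Z)%:C *
    \prod_i g i (x.+1%:Z + b i * (if side i then m2.+1 else m1.+1)%:Z).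

(** Expanding each g_i into real and imaginary parts gives one real count per set [J] of indices
    contributing the real part, with a coefficient of modulus 1; both parts obey the majorant of
    g_i. *)
Lemma complex_slice_bound (g : I -> int -> R[i]) :
  (forall i x, cmod (g i x) <= majorant nn nu al be i x) ->
  cmod (\sum_(m1 < H) \sum_(m2 < H) complex_slice g m1 m2) <= 2 ^+ #|I| * c.
Proof.
move=> g_le.
pose G (J : {set I}) i x := if i \in J then complex.Re (g i x) else complex.Im (g i x).
pose w (J : {set I}) : R[i] := \prod_(i : I) (if i \in J then 1 else 'i%C).
have sliceE m1 m2 : complex_slice g m1 m2 = \sum_(J : {set I}) w J * (slice nn nu side b (G J) m1 m2)%:C.
  rewrite /complex_slice; under [RHS]eq_bigr do rewrite rmorph_sum mulr_sumr.
  rewrite [RHS]exchange_big /=; apply: eq_bigr => x _.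
  pose pt i := x.+1%:Z + b i * (if side i then m2.+1 else m1.+1)%:Z.
  rewrite (eq_bigr (fun i => (complex.Re (g i (pt i)))%:C + 'i%C * (complex.Im (g i (pt i)))%:C)); last first.
    by move=> i _; rewrite -complexE.
  rewrite bigA_distr mulr_sumr; apply: eq_bigr => J _.
  rewrite rmorphM /= mulrCA; congr (_ * _).
  rewrite rmorph_prod -big_split /=; apply: eq_bigr => i _.
  by rewrite /G; case: ifP; rewrite ?mul1r.
have -> : \sum_(m1 < H) \sum_(m2 < H) complex_slice g m1 m2 =
    \sum_(J : {set I}) w J * (\sum_(m1 < H) \sum_(m2 < H) slice nn nu side b (G J) m1 m2)%:C.
  under [LHS]eq_bigr do under eq_bigr do rewrite sliceE.
  under [LHS]eq_bigr do rewrite exchange_big.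
  rewrite exchange_big; apply: eq_bigr => J _.
  rewrite rmorph_sum mulr_sumr; apply: eq_bigr => m1 _.
  by rewrite rmorph_sum mulr_sumr.
apply: le_trans (cmod_sum _) _.
apply: le_trans (_ : \sum_(J : {set I}) c <= _); last first.
  have -> : 2 ^+ #|I| = #|{: {set I}}|%:R :> R.
    rewrite -natrX; congr (_%:R); rewrite -[in LHS]cardsT -card_powerset.
    by apply: eq_card => J; rewrite powersetE finset.subsetT.
  by rewrite sumr_const mulr_natl.
apply: ler_sum => J _; rewrite cmodM cmod_real cmod_prod big1 ?mul1r; last first.
  by move=> i _; case: ifP => _; rewrite ?cmod_i // -(rmorph1 (real_complex R)) cmod_real normr1.
apply: real_bound => i x; apply: le_trans (g_le i x).
by rewrite /G; case: ifP => _; [apply: Re_le_cmod|apply: Im_le_cmod].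
Qed.

End ComplexCount.

(** * Pairs of shift vectors *)

Section PairSums.
Variables (R : realType) (d w : nat).

Let J := ('I_d + 'I_d)%type.

Definition lpart (F : {ffun J -> 'I_w}) : {ffun 'I_d -> 'I_w} := [ffun j => F (inl j)].
Definition rpart (F : {ffun J -> 'I_w}) : {ffun 'I_d -> 'I_w} := [ffun j => F (inr j)].

Lemma sum_parts (V : nmodType) (Z : {ffun 'I_d -> 'I_w} -> {ffun 'I_d -> 'I_w} -> V) :
  \sum_f \sum_f' Z f f' = \sum_(F : {ffun J -> 'I_w}) Z (lpart F) (rpart F).
Proof.
rewrite pair_bigA /= (reindex (fun F : {ffun J -> 'I_w} => (lpart F, rpart F))) //=.
apply: onW_bij; exists (fun p : {ffun 'I_d -> 'I_w} * {ffun 'I_d -> 'I_w} =>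
  [ffun i : J => match i return 'I_w with inl j => p.1 j | inr j => p.2 j end]).
  by move=> F; apply/ffunP => -[j|j]; rewrite !ffunE.
by move=> [f f']; congr (_, _); apply/ffunP => j; rewrite !ffunE.
Qed.

(** The two shift vectors merge into one family indexed by [J], whose tag [inl] or [inr] records
    which of m1 and m2 is used. *)
Lemma product_pair_sum (V : comPzRingType) (H : nat) (a a' : {ffun 'I_d -> 'I_w} -> V)
    (P P' : {ffun 'I_d -> 'I_w} -> nat -> 'I_d -> V) :
  (\sum_f a f * \sum_(m < H) \prod_j P f m j) * (\sum_f a' f * \sum_(m < H) \prod_j P' f m j)
  = \sum_(F : {ffun J -> 'I_w}) a (lpart F) * a' (rpart F) *
      \sum_(m1 < H) \sum_(m2 < H) \prod_(i : J)
        match i return V with inl j => P (lpart F) m1 j | inr j => P' (rpart F) m2 j end.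
Proof.
rewrite mulr_suml; under eq_bigr do rewrite mulr_sumr.
rewrite (sum_parts (fun f f' => a f * (\sum_(m < H) \prod_j P f m j) *
  (a' f' * \sum_(m < H) \prod_j P' f' m j))).
apply: eq_bigr => F _; rewrite mulrACA; congr (_ * _).
rewrite mulr_suml; apply: eq_bigr => m1 _; rewrite mulr_sumr; apply: eq_bigr => m2 _.
by rewrite big_sumType.
Qed.

End PairSums.

(** * Degenerate shift vectors *)

Section GenericCount.
Variables (R : realType) (I : finType) (w : nat) (z0 : 'I_w).

Definition generic (F : {ffun I -> 'I_w}) : bool :=
  [forall i, (F i != z0) && [forall j, (F i == F j) ==> (i == j)]].

(** Once the other coordinates are fixed, exactly one of the [w] values of coordinate [i] satisfies
    the equation. *)
Lemma count_determined (i : I) (phi : {ffun I -> 'I_w} -> 'I_w) :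
  (forall F p, phi (upd F i p) = phi F) ->
  w%:R * \sum_(F : {ffun I -> 'I_w}) (F i == phi F)%:R = #|{ffun I -> 'I_w}|%:R :> R.
Proof.
move=> phi_upd; rewrite -[X in X%:R * _]card_ord -(sum_upd _ i) -sum1_card natr_sum.
apply: eq_bigr => F _; rewrite (bigD1 (phi F)) //= upd_eq phi_upd eqxx big1 ?addr0 //.
by move=> p /negbTE pF; rewrite upd_eq phi_upd pF.
Qed.

(* Multiplied by w to avoid the exponent #|I| - 1. *)
Lemma generic_sum_bound (Z : {ffun I -> 'I_w} -> R) (gb tb : R) : 0 <= gb -> 0 <= tb ->
  (forall F, generic F -> Z F <= gb) -> (forall F, Z F <= tb) ->
  w%:R * \sum_F Z F
  <= #|{ffun I -> 'I_w}|%:R * (w%:R * gb + (#|I| + #|I| * #|I|)%:R * tb).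
Proof.
move=> gb0 tb0 Zg Zt.
(* A union bound: [bad1] counts zero shifts and [bad2] coincidences, so their sum is at least 1 off
   the generic set. *)
pose bad1 (F : {ffun I -> 'I_w}) : R := \sum_i (F i == z0)%:R.
pose bad2 (F : {ffun I -> 'I_w}) : R := \sum_i \sum_(j | j != i) (F i == F j)%:R.
have b10 F : 0 <= bad1 F by apply: sumr_ge0.
have b20 F : 0 <= bad2 F by apply: sumr_ge0 => i _; apply: sumr_ge0.
have Zle F : Z F <= gb + (bad1 F + bad2 F) * tb.
  have [gF|] := boolP (generic F).
    by apply: le_trans (Zg _ gF) _; rewrite lerDl mulr_ge0 ?addr_ge0.
  move=> ngF; apply: le_trans (Zt F) _; apply: le_trans (_ : (bad1 F + bad2 F) * tb <= _); last by rewrite lerDr.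
  rewrite -[X in X <= _]mul1r ler_wpM2r //.
  move: ngF; rewrite negb_forall => /existsP[ i ]; rewrite negb_and negbK => /orP[/eqP Fi|].
    apply: le_trans (_ : bad1 F <= _); last by rewrite lerDl.
    by rewrite /bad1 (bigD1 i) //= Fi eqxx lerDl sumr_ge0.
  rewrite negb_forall => /existsP[ j ]; rewrite negb_imply => /andP[/eqP Fij ij].
  apply: le_trans (_ : bad2 F <= _); last by rewrite lerDr.
  rewrite /bad2 (bigD1 i) //= (bigD1 (P := fun j => j != i) j) 1?eq_sym //= Fij eqxx -addrA lerDl.
  by rewrite addr_ge0 ?sumr_ge0 // => k _; apply: sumr_ge0.
have w0 : 0 <= w%:R :> R by [].
have Zsum : \sum_F Z F <= \sum_F (gb + (bad1 F + bad2 F) * tb) by apply: ler_sum => F _.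
apply: le_trans (ler_wpM2l w0 Zsum) _.
rewrite big_split /= sumr_const -mulr_suml big_split /= mulrDr mulrA mulrDr.
have -> : w%:R * \sum_F bad1 F = #|I|%:R * #|{ffun I -> 'I_w}|%:R.
  rewrite exchange_big mulr_sumr /= (eq_bigr (fun=> #|{ffun I -> 'I_w}|%:R)).
    by rewrite sumr_const mulr_natl.
  by move=> i _; apply: (count_determined (phi := fun=> z0)).
have b2 : w%:R * \sum_F bad2 F <= (#|I| * #|I|)%:R * #|{ffun I -> 'I_w}|%:R.
  rewrite exchange_big mulr_sumr /=.
  apply: le_trans (_ : \sum_(i : I) #|I|%:R * #|{ffun I -> 'I_w}|%:R <= _); last first.
    by rewrite sumr_const -[leLHS]mulr_natl mulrA -natrM.
  apply: ler_sum => i _; rewrite exchange_big mulr_sumr /=.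
  apply: le_trans (_ : \sum_(j : I | j != i) #|{ffun I -> 'I_w}|%:R <= _).
    apply: ler_sum => j ji; rewrite (count_determined (phi := fun F => F j)) // => F p.
    by rewrite upd_neq.
  have -> : #|I|%:R * #|{ffun I -> 'I_w}|%:R = \sum_(j : I) #|{ffun I -> 'I_w}|%:R :> R.
    by rewrite sumr_const mulr_natl.
  by rewrite [leRHS](bigD1 i) //= lerDr.
rewrite -[gb *+ _]mulr_natr.
apply: le_trans (_ : w%:R * (gb * #|{ffun I -> 'I_w}|%:R) + (#|I|%:R * #|{ffun I -> 'I_w}|%:R
    + (#|I| * #|I|)%:R * #|{ffun I -> 'I_w}|%:R) * tb <= _).
  by rewrite lerD2l ler_wpM2r // lerD2l.
move: (#|{ffun I -> 'I_w}|%:R : R) => c.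
by rewrite natrD le_eqVlt; apply/orP; left; apply/eqP; ring.
Qed.

End GenericCount.

(** * Dual functions *)

Section DualFunction.
Variables (R : realType) (d : nat) (K L eta N C0 : R) (H nn bt : nat) (nu : int -> R).
Let B := N / H%:R.
Hypothesis lfc : linear_forms_condition K L eta N B H nu.
Hypothesis nnN : nn%:R <= N < nn.+1%:R.
Hypothesis nn0 : (0 < nn)%N.
Hypothesis H0 : (0 < H)%N.
Hypothesis d0 : (0 < d)%N.
Hypothesis B1 : 1 <= B.
Hypothesis L2 : 2 <= L.
Hypothesis eta01 : 0 < eta < 1.
Hypothesis nu0 : forall x, 0 <= nu x.
Hypothesis nu_supp : forall x, ~~ (1 <= x <= nn%:Z) -> nu x = 0.
Hypothesis C01 : 1 <= C0.
Hypothesis btP : bt%:R <= C0 * B < bt.+1%:R.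

Let w := bt.*2.+1.
Let I := ('I_d + 'I_d)%type.
Let nI := #|{: I}|.

Definition window_radius : nat := (Num.truncn (2 * (nI%:R * C0))).+1.

(** This becomes K_0. It adds up what the order K has to dominate: sizes of coefficients and
    constant terms, numbers of forms and of variables, and the radius of the range of translates of
    [N]. *)
Definition order_bound : R :=
  2 * C0 + 2 + #|{: unit + I}|%:R + #|{: {set I} + I * {set I}}|%:R + #|{: bool + I * bool}|%:R
  + window_radius%:R.

Hypothesis K_ge : order_bound <= K.

Let es := eta + L^-1 + H%:R^-1.
Let ec := es `^ (2 ^+ nI)^-1.

(** The shifts in [-C0 B, C0 B] are stored as ordinals below 2 bt + 1, with bt the integer part of
    C0 B; [mid] stands for the shift 0. *)
Definition center (i : 'I_w) : int := i%:Z - bt%:Z.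
Definition mid : 'I_w := inord bt.
Definition shifts (F : {ffun I -> 'I_w}) (i : I) : int := center (F i).
Definition side_of (i : I) : bool := if i is inr _ then true else false.

Lemma center_inj : injective center.
Proof. by move=> i j /addIr [] /val_inj. Qed.

Lemma center_norm_le i : `|center i|%:~R <= C0 * B.
Proof.
have := btP => /andP[b1 _]; apply: le_trans b1; rewrite pmulrn ler_int.
have := ltn_ord i; rewrite /center /w; move: (nat_of_ord i) => j; clear; lia.
Qed.

Lemma generic_shifts F : generic mid F -> injective (shifts F) /\ forall i, shifts F i != 0.
Proof.
move=> /forallP gF; split=> [i j|i].
  move=> /center_inj Fij; have /andP[_ /forallP/(_ j)] := gF i.
  by rewrite Fij eqxx => /eqP.
have /andP[Fi _] := gF i; apply: contra Fi => /eqP Fi0; apply/eqP; apply: center_inj.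
rewrite [LHS]Fi0 /center /mid inordK ?subrr // /w ltnS; clear; lia.
Qed.

Lemma K_bounds : [/\ 2 * C0 <= K, 2 <= K, #|{: unit + I}|%:R <= K,
  #|{: {set I} + I * {set I}}|%:R <= K & #|{: bool + I * bool}|%:R <= K] /\ window_radius%:R <= K.
Proof.
have := K_ge; rewrite /order_bound => KK.
have := C01; have h n : 0 <= n%:R :> R by [].
have := h #|{: unit + I}|; have := h #|{: {set I} + I * {set I}}|;
have := h #|{: bool + I * bool}|; have := h window_radius.
move: KK; move: (#|{: unit + I}|%:R : R) (#|{: {set I} + I * {set I}}|%:R : R)
  (#|{: bool + I * bool}|%:R : R) (window_radius%:R : R) => a b c e.
by move=> *; do !split; lra.
Qed.

(** Rounding H / L up to the next integer keeps q admissible as a length and costs the term 1, the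
    origin of H^-1 in the error; L >= 2 ensures q <= H. *)
Lemma block_length : exists q : nat,
  [/\ (0 < q)%N, (q <= H)%N, H%:R / L <= q%:R & q%:R <= H%:R / L + 1].
Proof.
have L0 : 0 < L by apply: lt_le_trans L2; rewrite ltr0n.
have HL0 : 0 <= H%:R / L by rewrite divr_ge0 // ltW.
have /andP[q1 q2] := truncn_itv HL0.
exists (Num.truncn (H%:R / L)).+1; split => //; last by rewrite -natr1 lerD2r.
  have HL2 : H%:R / L <= H%:R / 2 by rewrite ler_wpM2l // lef_pV2 ?posrE.
  have [H1|H1] := ltnP 1 H; last first.
    have HE : H = 1%N by apply/eqP; rewrite eqn_leq H1 H0.
    rewrite [X in (_ < X)%N]HE ltnS leqNgt; apply/negP => t0.
    have h1 : 1 <= (Num.truncn (H%:R / L))%:R :> R by rewrite ler1n.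
    have := le_trans h1 (le_trans q1 HL2).
    by rewrite HE leNgt mul1r invf_lt1 ?ltr1n.
  rewrite -(ltr_nat R); apply: le_lt_trans q1 _; apply: le_lt_trans HL2 _.
  by rewrite ltr_pdivrMr // ltr_pMr ?ltr0n // ltr1n.
exact: ltW.
Qed.

Lemma es_ge0 : 0 <= es.
Proof.
have := eta01 => /andP[/ltW e0 _]; rewrite !addr_ge0 ?invr_ge0 //.
by apply: le_trans L2; rewrite ler0n.
Qed.

Lemma es_le3 : es <= 3.
Proof.
have := eta01 => /andP[_ /ltW e1].
have h1 : L^-1 <= 1.
  by rewrite invf_le1 ?(le_trans _ L2) ?(lt_le_trans _ L2) ?ltr0n ?ler1n.
have h2 : H%:R^-1 <= 1 :> R by rewrite invf_le1 ?ltr0n // ler1n.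
by rewrite /es; lra.
Qed.

Lemma error_le : eta `^ (2 ^+ nI)^-1 + (L^-1 + H%:R^-1) <= 4 * ec.
Proof.
have := eta01 => /andP[/ltW e0 _].
have L0 : 0 <= L^-1 by rewrite invr_ge0 (le_trans _ L2).
have Hi0 : 0 <= H%:R^-1 :> R by rewrite invr_ge0.
have c0 : 0 < (2 ^+ nI)^-1 :> R by rewrite invr_gt0 exprn_gt0.
have c1 : (2 ^+ nI)^-1 <= 1 :> R by rewrite invf_le1 ?exprn_gt0 // exprn_ege1 // ler1n.
have -> : 4 * ec = ec + 3 * ec by ring.
rewrite lerD //.
  apply: ge0_ler_powR; rewrite ?nnegrE ?es_ge0 //.
  by rewrite /es -addrA lerDl addr_ge0.
apply: le_trans (le_three_powR es_ge0 es_le3 c0 c1).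
by rewrite /es -addrA lerDr.
Qed.

Lemma generic_slice_bound (F : {ffun I -> 'I_w}) (al be : I -> R) (G : I -> int -> R) :
  generic mid F -> (forall i, 0 <= al i) -> (forall i, 0 <= be i) -> (forall i, al i + be i <= 1) ->
  (forall i x, `|G i x| <= majorant nn nu al be i x) ->
  `|\sum_(m1 < H) \sum_(m2 < H) slice nn nu side_of (shifts F) G m1 m2|
  <= 4 * count_const R I window_radius * ((nn * (H * H))%:R * ec).
Proof.
move=> /generic_shifts [Finj Fn0] al0 be0 albe G_le.
have [[KC K2 KI KT KV] KTw] := K_bounds.
have [q [q0 qH qL q_le]] := block_length.
have BH : B * H%:R = N by rewrite /B divfK // pnatr_eq0 -lt0n.
have I0 : (0 < #|{: I}|)%N by rewrite card_sum card_ord addn_gt0 d0.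
have Tw_ge : 2 * (#|{: I}|%:R * C0) <= window_radius%:R.
  have /truncn_itv/andP[_ /ltW] : 0 <= 2 * (nI%:R * C0) by rewrite !mulr_ge0 // (le_trans _ C01).
  by [].
have F_le i : `|shifts F i|%:~R <= C0 * B by apply: center_norm_le.
apply: le_trans (slice_count_bound lfc nnN nn0 H0 BH B1 L2 eta01 nu0 nu_supp C01 side_of
  Finj Fn0 F_le KC K2 KI al0 be0 albe qH qL KT KV KTw G_le q0 I0 q_le Tw_ge) _.
have cc0 : 0 <= count_const R I window_radius.
  apply: addr_ge0; first by do 2!apply: mulr_ge0 => //; apply: exprn_ge0.
  by do 2!apply: mulr_ge0 => //; apply: addr_ge0 => //; apply: exprn_ge0.
rewrite [leRHS](_ : _ = count_const R I window_radius * (nn * (H * H))%:R * (4 * ec)).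
  by rewrite ler_wpM2l ?mulr_ge0 // error_le.
move: (count_const R I window_radius) ((nn * (H * H))%:R : R) => x y; ring.
Qed.

(** * The dual function and its squared modulus *)

Variables (mu : {ffun 'I_d -> int} -> R[i]) (S : {set 'I_d}) (g : 'I_d -> int -> R[i]).
Hypothesis mu_le : forall b, cmod (mu b) <= 1.
Hypothesis mu_supp : forall b, mu b != 0 -> forall i, - (C0 * B) <= (b i)%:~R <= C0 * B.
Let sa (j : 'I_d) : R := (j \in S)%:R.
Let sb (j : 'I_d) : R := 1 - sa j.
Hypothesis g_le : forall j x, cmod (g j x) <= majorant nn nu sa sb j x.
Variable Rn : R.
Hypothesis Rn1 : 1 <= Rn.
Hypothesis nu_le : forall x, nu x <= Rn.

Let M := B ^+ d * H%:R.
Let D := @dual_function R d.+1 N B H mu g.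

Definition shift_of (f : {ffun 'I_d -> 'I_w}) : {ffun 'I_d -> int} := [ffun j => center (f j)].

Lemma shift_of_inj : injective shift_of.
Proof.
move=> f f' /ffunP ff; apply/ffunP => j; apply: center_inj.
by have := ff j; rewrite !ffunE.
Qed.

Lemma mu_shift b : mu b != 0 -> exists f, b = shift_of f.
Proof.
move=> /mu_supp b_le.
have bP j : exists i : 'I_w, b j = center i.
  have /andP[bl bu] := b_le j; have := btP => /andP[_ bt2].
  have b1 : b j < bt.+1%:Z by rewrite -(ltr_int R) -pmulrn; apply: le_lt_trans bu bt2.
  have b2 : - bt.+1%:Z < b j.
    by rewrite -(ltr_int R) rmorphN /= -pmulrn; apply: lt_le_trans bl; rewrite ltrN2.
  have iw : (`|(b j + bt%:Z)%R|%N < w)%N by move: b1 b2; rewrite /w; clear; lia.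
  by exists (Ordinal iw); rewrite /center /=; move: b1 b2; clear; lia.
have [f fP] := choice bP.
by exists [ffun j => f j]; apply/ffunP => j; rewrite !ffunE fP.
Qed.

(** mu vanishes off the range of [shift_of], which makes the sum finite. With k = d + 1 and d > 0,
    B^(k-2) N = B^d H = M. *)
Lemma dual_finite x : D x = (M^-1)%:C *
  \sum_f mu (shift_of f) * \sum_(m < H) \prod_j g j (x + center (f j) * m.+1%:Z).
Proof.
have BH : B * H%:R = N by rewrite /B divfK // pnatr_eq0 -lt0n.
have ME : B ^+ (d.+1 - 2) * N = M.
  rewrite /M -BH mulrA; case: d d0 => // d' _.
  by rewrite !subSS subn0 exprSr.
rewrite /D /dual_function ME; congr (_ * _).
rewrite -(fsbig_widen (range shift_of)) //; last first.
  move=> b [_ nb] /=; have [->|mb] := eqVneq (mu b) 0; first by rewrite mul0r.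
  by have [f bf] := mu_shift mb; case: nb; exists f.
have [|_ ->] := fsum_reindex (fun b => mu b * \sum_(m \in bracket (H%:R : R)) \prod_(i < d) g i (x + b i * m))
  shift_of_inj (A := range shift_of).
  by move=> b; split=> [[f _ <-]|[f ->]]; exists f.
apply: eq_bigr => f _; congr (_ * _).
have HR : (H%:R <= (H%:R : R)) && ((H%:R : R) < H.+1%:R) by rewrite lexx ltr_nat ltnS leqnn.
have [||_ ->] := fsum_reindex (h := fun m : 'I_H => m.+1%:Z) (A := bracket (H%:R : R))
  (fun m => \prod_(i < d) g i (x + shift_of f i * m)).
- by move=> i j [] /val_inj.
- by move=> m; rewrite (bracket_floor HR) /= bracket_ord.
by apply: eq_bigr => m _; apply: eq_bigr => j _; rewrite ffunE.
Qed.

Definition doubled (i : I) (z : int) : R[i] :=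
  match i with inl j => g j z | inr j => conjc (g j z) end.

Definition mu_pair (F : {ffun I -> 'I_w}) : R[i] :=
  mu (shift_of (lpart F)) * conjc (mu (shift_of (rpart F))).

Lemma dual_sqr x : (cmod (D x) ^+ 2)%:C = (M ^- 2)%:C * \sum_F mu_pair F *
  \sum_(m1 < H) \sum_(m2 < H)
    \prod_i doubled i (x + shifts F i * (if side_of i then m2.+1 else m1.+1)%:Z).
Proof.
rewrite cmod_sqr dual_finite conjcM conjc_real mulrACA.
rewrite -(rmorphM (real_complex R)) -invfM -expr2; congr (_ * _).
rewrite conjc_sum.
rewrite [X in _ * X](eq_bigr (fun f => conjc (mu (shift_of f)) *
  \sum_(m < H) \prod_j conjc (g j (x + center (f j) * m.+1%:Z)))); last first.
  move=> f _; rewrite conjcM conjc_sum; congr (_ * _).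
  by apply: eq_bigr => m _; rewrite conjc_prod.
rewrite (product_pair_sum H _ _ (fun f m j => g j (x + center (f j) * m.+1%:Z))
  (fun f m j => conjc (g j (x + center (f j) * m.+1%:Z)))).
apply: eq_bigr => F _; congr (_ * _).
apply: eq_bigr => m1 _; apply: eq_bigr => m2 _; apply: eq_bigr => -[j|j] _ /=; by rewrite ffunE.
Qed.

Lemma indN_ord (x : 'I_nn) : indN R nn x.+1%:Z = 1.
Proof. by rewrite /indN lez_nat ltn_ord. Qed.

(** The triangle inequality over pairs of shift vectors discards mu; the cancellation comes from the
    sums over x, m1 and m2 within one pair. *)
Lemma weighted_dual_bound :
  `|\sum_(x < nn) (nu x.+1%:Z - 1) * cmod (D x.+1%:Z) ^+ 2|
  <= M ^- 2 * \sum_F cmod (\sum_(m1 < H) \sum_(m2 < H)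
       complex_slice nn nu side_of (shifts F) doubled m1 m2).
Proof.
have M2 : 0 <= M ^- 2 by rewrite invr_ge0 sqr_ge0.
rewrite -cmod_real rmorph_sum /=.
rewrite (_ : \sum_(x < nn) _ = (M ^- 2)%:C * \sum_F mu_pair F *
  \sum_(m1 < H) \sum_(m2 < H) complex_slice nn nu side_of (shifts F) doubled m1 m2).
  rewrite cmodM cmod_real ger0_norm // ler_wpM2l //.
  apply: le_trans (cmod_sum _) _; apply: ler_sum => F _.
  rewrite cmodM -[leRHS]mul1r ler_wpM2r ?cmod_ge0 //.
  by rewrite /mu_pair cmodM cmod_conj -[leRHS]mul1r ler_pM ?cmod_ge0.
rewrite (eq_bigr (fun x : 'I_nn => (M ^- 2)%:C * \sum_F mu_pair F *
   \sum_(m1 < H) \sum_(m2 < H) (nu x.+1%:Z - indN R nn x.+1%:Z)%:C *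
    \prod_i doubled i (x.+1%:Z + shifts F i * (if side_of i then m2.+1 else m1.+1)%:Z))); last first.
  move=> x _; rewrite rmorphM /= dual_sqr mulrCA; congr (_ * _).
  rewrite mulr_sumr; apply: eq_bigr => F _; rewrite mulrCA; congr (_ * _).
  rewrite indN_ord mulr_sumr; apply: eq_bigr => m1 _.
  by rewrite mulr_sumr.
rewrite -mulr_sumr exchange_big; congr (_ * _); apply: eq_bigr => F _.
rewrite -mulr_sumr exchange_big; congr (_ * _); apply: eq_bigr => m1 _.
by rewrite exchange_big.
Qed.

(** There are w^nI pairs with B <= w <= 3 C0 B, against M^2 = B^nI H^2, hence (3 C0)^nI. The
    degenerate proportion O(1/w) becomes O(1/B). *)
Lemma total_bound (Z : {ffun I -> 'I_w} -> R) (G1 G2 : R) : 0 <= G1 -> 0 <= G2 ->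
  (forall F, generic mid F -> Z F <= G1 * ((nn * (H * H))%:R * ec)) ->
  (forall F, Z F <= G2 * ((nn * (H * H))%:R * Rn ^+ nI.+1)) ->
  M ^- 2 * (\sum_F Z F) / nn%:R <=
  (3 * C0) ^+ nI * (G1 + (nI + nI * nI)%:R * G2) * (ec + Rn ^+ nI.+1 / B).
Proof.
move=> G10 G20 Zg Zt.
have ec0 : 0 <= ec by apply: powR_ge0.
have R0 : 0 <= Rn ^+ nI.+1 by rewrite exprn_ge0 // (le_trans _ Rn1).
have P0 : 0 <= (nn * (H * H))%:R :> R by [].
have B0 : 0 < B by apply: lt_le_trans B1.
have BL : B <= C0 * B by rewrite ler_peMl // ltW.
have /andP[b1 b2] := btP.
have wE : w%:R = 2 * bt%:R + 1 :> R by rewrite /w -addn1 natrD -mul2n natrM.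
have wB : B <= w%:R.
  by apply: le_trans BL (le_trans (ltW b2) _); rewrite ler_nat ltnS -addnn leq_addr.
have w3 : w%:R <= 3 * C0 * B by rewrite wE; have := B1 => ?; lra.
have w0 : 0 < w%:R :> R by apply: lt_le_trans wB.
have H0' : 0 < H%:R :> R by rewrite ltr0n.
have n0' : 0 < nn%:R :> R by rewrite ltr0n.
have := generic_sum_bound (mulr_ge0 G10 (mulr_ge0 P0 ec0)) (mulr_ge0 G20 (mulr_ge0 P0 R0)) Zg Zt.
have -> : #|{ffun I -> 'I_w}|%:R = w%:R ^+ nI :> R by rewrite card_ffun card_ord natrX.
rewrite -/nI => key.
have ME : M ^+ 2 = B ^+ nI * (H%:R * H%:R).
  rewrite /M /nI card_sum !card_ord exprMn -exprM mulnC mul2n addnn expr2.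
  by congr (_ * _).
have BI0 : 0 < B ^+ nI by rewrite exprn_gt0.
rewrite ler_pdivrMr // ler_pdivrMl ?exprn_gt0 ?mulr_gt0 ?exprn_gt0 // -(ler_pM2l w0).
apply: le_trans key _; rewrite ME.
have wI : w%:R ^+ nI <= (3 * C0) ^+ nI * B ^+ nI.
  by rewrite -exprMn lerXn2r // nnegrE (le_trans (ltW w0)).
set n2 := (nI + nI * nI)%:R : R; have n20 : 0 <= n2 by [].
have h1 : G2 * ((nn * (H * H))%:R * Rn ^+ nI.+1) <= w%:R * (G2 * ((nn * (H * H))%:R * (Rn ^+ nI.+1 / B))).
  rewrite [leRHS]mulrCA ler_wpM2l // [leRHS]mulrCA ler_wpM2l // [leRHS]mulrCA -[leLHS]mulr1 ler_wpM2l //.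
  by rewrite ler_pdivlMr // mul1r.
have h2 := ler_wpM2l n20 h1.
set X := (nn * (H * H))%:R : R.
have RB0 : 0 <= Rn ^+ nI.+1 / B by rewrite divr_ge0 // ltW.
apply: le_trans (_ : (3 * C0) ^+ nI * B ^+ nI * (w%:R * (G1 * (X * ec)) +
  n2 * (w%:R * (G2 * (X * (Rn ^+ nI.+1 / B))))) <= _).
  have wI0 : 0 <= w%:R ^+ nI :> R by rewrite exprn_ge0.
  have sum0 : 0 <= w%:R * (G1 * (X * ec)) + n2 * (G2 * (X * Rn ^+ nI.+1)).
    by apply: addr_ge0; rewrite !mulr_ge0.
  by apply: ler_pM wI0 sum0 wI _; rewrite lerD2l.
have XE : X = nn%:R * (H%:R * H%:R) by rewrite /X !natrM.
have C3 : 0 <= (3 * C0) ^+ nI by rewrite exprn_ge0 // mulr_ge0 // (le_trans _ C01).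
by rewrite XE; apply: generic_total_le => //; apply: ltW.
Qed.

Lemma sa01 j : 0 <= sa j <= 1.
Proof. by rewrite /sa ler0n (ler_nat R _ 1) leq_b1. Qed.

Definition weight (u : bool) (j : 'I_d) : R := if u then sa j else 0.

Definition weight_pair (u u' : bool) (i : I) : R :=
  match i with inl j => weight u j | inr j => weight u' j end.

Lemma weight01 u j : 0 <= weight u j <= 1.
Proof. by case: u; rewrite /weight ?sa01 // lexx ler01. Qed.

Lemma weight_pair01 u u' i : 0 <= weight_pair u u' i <= 1.
Proof. by case: i => j; apply: weight01. Qed.

Lemma majorant_le (T : finType) (al : T -> R) i x : (forall i, 0 <= al i <= 1) ->
  0 <= majorant nn nu al (fun i => 1 - al i) i x <= Rn.
Proof.
move=> /(_ i)/andP[a0 a1]; have i0 : 0 <= indN R nn x by [].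
have i1 : indN R nn x <= Rn.
  by apply: le_trans Rn1; rewrite /indN (ler_nat R _ 1) leq_b1.
have := nu0 x; have := nu_le x; rewrite /majorant.
move: (nu x) (indN R nn x) (al i) a0 a1 i0 i1 => v y a a0 a1 i0 i1 vR v0.
by apply: convex_between.
Qed.

Lemma doubled_le i x : cmod (doubled i x) <=
  majorant nn nu (weight_pair true true) (fun i => 1 - weight_pair true true i) i x.
Proof. by case: i => j /=; rewrite ?cmod_conj; apply: g_le. Qed.

Lemma balanced_le x : `|nu x - indN R nn x| <= Rn.
Proof.
have := nu0 x; have := nu_le x; have i0 : 0 <= indN R nn x by [].
have i1 : indN R nn x <= Rn by apply: le_trans Rn1; rewrite /indN (ler_nat R _ 1) leq_b1.
by move=> ? ?; rewrite ler_norml; apply/andP; split; lra.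
Qed.

Lemma sum3_le (f : nat -> nat -> nat -> R) (c : R) : (forall x m1 m2, f x m1 m2 <= c) ->
  \sum_(x < nn) \sum_(m1 < H) \sum_(m2 < H) f x m1 m2 <= (nn * (H * H))%:R * c.
Proof.
move=> fc.
apply: le_trans (_ : \sum_(x < nn) \sum_(m1 < H) \sum_(m2 < H) c <= _).
  by do 3!(apply: ler_sum => ? _).
by rewrite !sumr_const !card_ord -!mulrnA mulr_natl mulnA mulnC mulnA.
Qed.

Definition part1_const : R :=
  (3 * C0) ^+ nI * (2 ^+ nI * (4 * count_const R I window_radius) + (nI + nI * nI)%:R * 1).

Lemma count_const_ge0 : 0 <= count_const R I window_radius.
Proof.
apply: addr_ge0; first by do 2!apply: mulr_ge0 => //; apply: exprn_ge0.
by do 2!apply: mulr_ge0 => //; apply: addr_ge0 => //; apply: exprn_ge0.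
Qed.

Lemma weighted_average_bound :
  `|\sum_(x < nn) (nu x.+1%:Z - 1) * cmod (D x.+1%:Z) ^+ 2| / nn%:R
  <= part1_const * (ec + Rn ^+ nI.+1 / B).
Proof.
apply: le_trans (ler_wpM2r _ weighted_dual_bound) _; first by rewrite invr_ge0.
apply: total_bound => //.
- by rewrite !mulr_ge0 ?exprn_ge0 // count_const_ge0.
- move=> F gF; rewrite -[leRHS]mulrA.
  apply: complex_slice_bound doubled_le => G G_le.
  apply: generic_slice_bound G_le => // i; have /andP[? ?] := weight_pair01 true true i => //.
  + by rewrite subr_ge0.
  + by rewrite subrKC.
(* For arbitrary pairs, each of the nI functions and the balanced factor is at most R_nu, whence the
   exponent nI + 1. *)
move=> F; rewrite mul1r /complex_slice.
apply: le_trans (cmod_sum _) _; apply: le_trans (ler_sum _ (fun m1 _ => cmod_sum _)) _.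
apply: le_trans (_ : \sum_(m1 < H) \sum_(m2 < H) \sum_(x < nn) Rn ^+ nI.+1 <= _); last first.
  by rewrite !sumr_const !card_ord -!mulrnA mulr_natl mulnA.
apply: ler_sum => m1 _; apply: ler_sum => m2 _; apply: le_trans (cmod_sum _) _.
apply: ler_sum => x _; rewrite cmodM cmod_real exprS ler_pM ?cmod_ge0 // ?balanced_le //.
rewrite cmod_prod -prodr_const; apply: ler_prod => i _; rewrite cmod_ge0 /=.
apply: le_trans (doubled_le _ _) _.
by have /andP[_ ->] := majorant_le i (x.+1%:Z + shifts F i * (if side_of i then m2.+1 else m1.+1)%:Z) (weight_pair01 true true).
Qed.

(** * Envelopes and truncation *)

Definition envelope (u : bool) (x : int) : R := M^-1 * \sum_(f : {ffun 'I_d -> 'I_w}) 1 * \sum_(m < H)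
  \prod_j majorant nn nu (weight u) (fun j => 1 - weight u j) j (x + center (f j) * m.+1%:Z).

Definition envelope_corr (u u' : bool) (F : {ffun I -> 'I_w}) : R :=
  \sum_(x < nn) \sum_(m1 < H) \sum_(m2 < H) \prod_i
    majorant nn nu (weight_pair u u') (fun i => 1 - weight_pair u u' i) i
      (window_point side_of (shifts F) 0 0 i x m1 m2).

Lemma envelope_mul u u' :
  \sum_(x < nn) envelope u x.+1%:Z * envelope u' x.+1%:Z = M ^- 2 * \sum_F envelope_corr u u' F.
Proof.
rewrite /envelope_corr exchange_big mulr_sumr; apply: eq_bigr => x _.
rewrite /envelope mulrACA -invfM -expr2; congr (_ * _).
rewrite (product_pair_sum H (fun=> 1) (fun=> 1)
  (fun f m j => majorant nn nu (weight u) (fun j => 1 - weight u j) j (x.+1%:Z + center (f j) * m.+1%:Z))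
  (fun f m j => majorant nn nu (weight u') (fun j => 1 - weight u' j) j (x.+1%:Z + center (f j) * m.+1%:Z))).
apply: eq_bigr => F _; rewrite !mul1r; apply: eq_bigr => m1 _; apply: eq_bigr => m2 _.
by apply: eq_bigr => -[j|j] _; rewrite /window_point /shifts ffunE /= addn0.
Qed.

(** 12 = 4 * 3: four correlations, and eta <= 3 ec. *)
Definition corr_const : R := 12 * 2 ^+ #|{: unit + I}|.

(** The two weights of each factor add up to 1, so the main term is the same for all [u] and [u'].
    The slot of x is filled with 1_[N]. *)
Lemma envelope_corr_generic u u' F : generic mid F ->
  `|envelope_corr u u' F - \sum_(x < nn) \sum_(m1 < H) \sum_(m2 < H) \prod_i
      indN R nn (window_point side_of (shifts F) 0 0 i x m1 m2)|
  <= 2 ^+ #|{: unit + I}| * eta * (nn * (H * H))%:R.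
Proof.
move=> /generic_shifts [Finj Fn0].
have [[KC K2 KI _ _] _] := K_bounds.
have BH : B * H%:R = N by rewrite /B divfK // pnatr_eq0 -lt0n.
have F_le i : `|shifts F i|%:~R <= C0 * B by apply: center_norm_le.
have L1 : 1 <= L by apply: le_trans L2; rewrite ler1n.
have HL : H%:R / L <= H%:R by rewrite ler_pdivrMr ?(lt_le_trans _ L1) // ler_peMr.
have al0 i : 0 <= weight_pair u u' i by have /andP[] := weight_pair01 u u' i.
have be0 i : 0 <= 1 - weight_pair u u' i by rewrite subr_ge0; have /andP[] := weight_pair01 u u' i.
have albe i : weight_pair u u' i + (1 - weight_pair u u' i) <= 1 by rewrite subrKC.
have n0 : `|0 : R| <= 1 by rewrite normr0.
have n1 : `|1 : R| <= 1 by rewrite normr1.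
have := pair_window_linear lfc nnN nn0 BH B1 L2 eta01 C01 side_of Finj Fn0 F_le KC K2 KI al0 be0 albe
  (leqnn H) (leqnn H) HL HL (leq0n _) (leq0n _) n0 n1.
rewrite (big1 _ _ (fun i => weight_pair u u' i + (1 - weight_pair u u' i))); last by move=> i _; rewrite subrKC.
rewrite add0r !mul1r; apply: le_trans; rewrite le_eqVlt; apply/orP; left; apply/eqP.
congr (`|_ - _|); apply: eq_bigr => x _; apply: eq_bigr => m1 _; apply: eq_bigr => m2 _.
by rewrite indN_ord mul0r add0r !mul1r.
Qed.

Lemma envelope_corr_trivial u u' F :
  `|envelope_corr u u' F| <= (nn * (H * H))%:R * Rn ^+ nI.+1.
Proof.
have m0 i x := majorant_le i x (weight_pair01 u u').
rewrite ger0_norm; last first.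
  apply: sumr_ge0 => x _; apply: sumr_ge0 => m1 _; apply: sumr_ge0 => m2 _.
  by apply: prodr_ge0 => i _; have /andP[] := m0 i (window_point side_of (shifts F) 0 0 i x m1 m2).
apply: (sum3_le (f := fun x m1 m2 => \prod_i
  majorant nn nu (weight_pair u u') (fun i => 1 - weight_pair u u' i) i
    (window_point side_of (shifts F) 0 0 i x m1 m2))) => x m1 m2; apply: le_trans (_ : Rn ^+ nI <= _).
  by rewrite -prodr_const; apply: ler_prod => i _; apply: m0.
by apply: ler_weXn2l.
Qed.

(** Expanding the square gives four correlations with signs +, -, +, -. Their common main term
    cancels, and the error is linear in eta. *)
Lemma envelope_diff_bound :
  (\sum_(x < nn) (envelope true x.+1%:Z - envelope false x.+1%:Z) ^+ 2) / nn%:R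
  <= (3 * C0) ^+ nI * (corr_const + (nI + nI * nI)%:R * 4) * (ec + Rn ^+ nI.+1 / B).
Proof.
pose Z F := envelope_corr true true F - envelope_corr true false F
  + (envelope_corr false false F - envelope_corr false true F).
have -> : \sum_(x < nn) (envelope true x.+1%:Z - envelope false x.+1%:Z) ^+ 2 = M ^- 2 * \sum_F Z F.
  rewrite big_split !sumrB /= mulrDr !mulrBr -!envelope_mul -!sumrB -big_split /=.
  by apply: eq_bigr => x _; ring.
have c0 : 0 <= 2 ^+ #|{: unit + I}| :> R by rewrite exprn_ge0.
apply: total_bound => //; first by rewrite mulr_ge0.
  move=> F gF; rewrite /Z; set S0 := \sum_(x < nn) \sum_(m1 < H) \sum_(m2 < H) \prod_i
      indN R nn (window_point side_of (shifts F) 0 0 i x m1 m2).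
  apply: le_trans (ler_norm _) _.
  have := norm_sub4_le (envelope_corr_generic true true gF) (envelope_corr_generic true false gF)
    (envelope_corr_generic false false gF) (envelope_corr_generic false true gF).
  rewrite -/S0 => h; apply: le_trans (le_trans _ h) _.
    by rewrite le_eqVlt; apply/orP; left; apply/eqP; congr (`|_|); ring.
  have eta_le : eta <= 3 * ec.
    apply: le_trans (le_three_powR es_ge0 es_le3 _ _); rewrite ?invr_gt0 ?exprn_gt0 //.
      rewrite /es -addrA lerDl addr_ge0 ?invr_ge0 //.
      by apply: le_trans L2; rewrite ler0n.
    by rewrite invf_le1 ?exprn_gt0 // exprn_ege1 // ler1n.
  rewrite /corr_const; have P0 : 0 <= (nn * (H * H))%:R :> R by [].
  move: (2 ^+ #|{: unit + I}| : R) c0 ((nn * (H * H))%:R : R) P0 eta_le.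
  move: ec eta => e t c c0 X X0 te.
  exact: fourfold_error_le.
move=> F; apply: le_trans (ler_norm _) _.
by apply: norm_sub4_le; apply: envelope_corr_trivial.
Qed.

Lemma dual_le_envelope x : cmod (D x) <= envelope true x.
Proof.
have M0 : 0 <= M^-1 by rewrite invr_ge0 mulr_ge0 // exprn_ge0 // (le_trans _ B1).
rewrite dual_finite cmodM cmod_real ger0_norm // ler_wpM2l //.
apply: le_trans (cmod_sum _) _; apply: ler_sum => f _; rewrite cmodM ler_pM ?cmod_ge0 //.
apply: le_trans (cmod_sum _) _; apply: ler_sum => m _.
by rewrite cmod_prod; apply: ler_prod => j _; rewrite cmod_ge0 g_le.
Qed.

(** The origin of K_bd: each coordinate has at most 2 C0 B + 1 <= (2 C0 + 1) B shifts and m has H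
    values, against M = B^d H. *)
Lemma envelope_false_le x : envelope false x <= (2 * C0 + 1) ^+ d.
Proof.
have B0 : 0 < B by apply: lt_le_trans B1.
have H0' : 0 < H%:R :> R by rewrite ltr0n.
rewrite /envelope ler_pdivrMl ?mulr_gt0 ?exprn_gt0 //.
apply: le_trans (_ : \sum_(f : {ffun 'I_d -> 'I_w}) \sum_(m < H) 1 <= _).
  apply: ler_sum => f _; rewrite mul1r; apply: ler_sum => m _.
  apply: Num.Theory.prodr_ile1 => j _.
  by rewrite /majorant mul0r add0r subr0 mul1r ler0n /indN (ler_nat R _ 1) leq_b1.
rewrite !sumr_const card_ord -mulrnA card_ffun !card_ord mulnC natrM natrX.
have C3 : 0 <= 2 * C0 + 1 by rewrite addr_ge0 // mulr_ge0 // (le_trans _ C01).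
have BC : 0 <= B * (2 * C0 + 1) by apply: mulr_ge0 => //; apply: ltW.
rewrite /M mulrAC ler_wpM2r // -exprMn lerXn2r ?nnegrE ?BC //.
have /andP[b1 _] := btP; rewrite /w -addn1 natrD -mul2n natrM.
by have := B1 => ?; lra.
Qed.

(** Clipping moves z by max(|z| - r, 0), and |z| - r <= E - E1. If z is not moved, E - E1 may be
    negative, but its square is not. *)
Lemma clip_diff_le (z : R[i]) (E E1 r : R) : cmod z <= E -> E1 <= r -> 0 <= r ->
  cmod (z - clip r z) ^+ 2 <= (E - E1) ^+ 2.
Proof.
move=> zE E1r r0; rewrite /clip; case: (leP (cmod z) r) => zr; first by rewrite subrr cmod0 expr0n sqr_ge0.
have z0 : 0 < cmod z by apply: le_lt_trans zr.
have -> : z - r%:C * z / (cmod z)%:C = z * (1 - r / cmod z)%:C.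
  by rewrite rmorphB rmorph1 mulrBr mulr1 rmorphM /= fmorphV mulrCA mulrA.
rewrite cmodM cmod_real ger0_norm; last by rewrite subr_ge0 ler_pdivrMr // mul1r ltW.
rewrite mulrBr mulr1 mulrCA mulfV ?gt_eqF // mulr1.
have h : 0 <= cmod z - r by rewrite subr_ge0 ltW.
have h2 : cmod z - r <= E - E1 by rewrite lerB.
by rewrite lerXn2r ?nnegrE // (le_trans h).
Qed.

Definition part2_const : R := (3 * C0) ^+ nI * (corr_const + (nI + nI * nI)%:R * 4).

Lemma clip_average_bound (r : R) : (2 * C0 + 1) ^+ d <= r ->
  (\sum_(x < nn) cmod (D x.+1%:Z - clip r (D x.+1%:Z)) ^+ 2) / nn%:R
  <= part2_const * (ec + Rn ^+ nI.+1 / B).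
Proof.
move=> Cr; apply: le_trans envelope_diff_bound; rewrite ler_wpM2r ?invr_ge0 //.
apply: ler_sum => x _; apply: clip_diff_le; first exact: dual_le_envelope.
  exact: le_trans (envelope_false_le _) Cr.
by apply: le_trans Cr; rewrite exprn_ge0 // addr_ge0 // mulr_ge0 // (le_trans _ C01).
Qed.

End DualFunction.

(** * Bounds for R_nu and the two estimates *)

Lemma Rnu_ge1 (R : realType) (N : R) (nu : int -> R) : 1 <= Rnu N nu.
Proof. by rewrite /Rnu le_max lexx. Qed.

Lemma le_Rnu (R : realType) (N : R) (nn : nat) (nu : int -> R) (x : int) :
  nn%:R <= N < nn.+1%:R -> (forall y, ~ bracket N y -> nu y = 0) -> nu x <= Rnu N nu.
Proof.
move=> nnN nu_supp; rewrite /Rnu le_max.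
have [xN|/nu_supp ->] := pselect (bracket N x); last by rewrite ler01.
apply/orP; right; apply: le_trans (ler_norm _) _; apply: ub_le_sup; last by exists x.
(* [sup] dominates only when the set is bounded above; the sum of all values on [N] is a bound. *)
exists (\sum_(i < nn) `|nu i.+1%:Z|) => _ [y yN <-].
move: yN; rewrite (bracket_floor nnN) /= bracket_ord => -[i ->].
by rewrite (bigD1 i) //= lerDl sumr_ge0.
Qed.

Theorem proposition6p4 (R : realType) (k : nat) (hk : (2 <= k)%N) :
  exists C : R, forall C0 : R, 1 <= C0 ->
  exists K0 A : R,
  forall (N : R) (H : nat), 1 <= N -> (0 < H)%N ->
  let B := N / H%:R in 1 <= B ->
  forall K L eta : R, 2 <= K -> K0 <= K -> 2 <= L -> 0 < eta < 1 ->
  forall nu : int -> R,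
    (forall x, 0 <= nu x) ->
    (forall x, ~ bracket N x -> nu x = 0) ->
    linear_forms_condition K L eta N B H nu ->
  let eta_star := eta + L^-1 + H%:R^-1 in
  let c : R := (2 ^+ (2 * (k - 1)))^-1 in
  forall mu : {ffun 'I_k.-1 -> int} -> R[i],
    (forall b, cmod (mu b) <= 1) ->
    (forall b, mu b != 0 -> forall i, - (C0 * B) <= (b i)%:~R <= C0 * B) ->
  forall (S : {set 'I_k.-1}) (g : 'I_k.-1 -> int -> R[i]),
    (forall i x, ~ bracket N x -> g i x = 0) ->
    (forall i, i \in S -> forall x, cmod (g i x) <= nu x) ->
    (forall i, i \notin S -> forall x, cmod (g i x) <= \1_(bracket N) x) ->
  let D := dual_function N B H mu g in
  forall Csup : R, C0 <= Csup ->
  let Kbd := (2 * Csup + 1) ^+ (k - 1) in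
  let Dsharp (x : int) : R[i] := (\1_(bracket N) x)%:C * clip Kbd (D x) in
  let bound := A * (eta_star `^ c + Rnu N nu `^ C / B) in
  `| avg (bracket N) (fun x => (nu x - 1) * cmod (D x) ^+ 2) | <= bound /\
  avg (bracket N) (fun x => cmod (D x - Dsharp x) ^+ 2) <= bound.
Proof.
case: k hk => [//|d] d0.
(* One power of R_nu for each of the 2 (k - 1) functions and one for nu - 1. *)
exists (d + d).+1%:R => C0 C01.
exists (order_bound d C0), (part1_const d C0 + part2_const d C0).
move=> N H N1 H0 B B1 K L eta _ K_ge L2 eta01 nu nu0 nu_supp lfc eta_star c mu mu_le mu_supp
  S g g_supp gS gnS D Csup C0sup Kbd Dsharp bound.
have N0 : 0 <= N by apply: le_trans N1.
have nnN := truncn_itv N0; set nn := Num.truncn N in nnN.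
have nn0 : (0 < nn)%N.
  have /andP[_ NS] := nnN; rewrite lt0n; apply/eqP => nnE; move: NS; rewrite nnE.
  by rewrite ltNge N1.
have btP : (Num.truncn (C0 * B))%:R <= C0 * B < (Num.truncn (C0 * B)).+1%:R.
  by apply: truncn_itv; rewrite mulr_ge0 ?(le_trans _ C01) ?(le_trans _ B1).
have brE := bracket_floor nnN.
have nu_supp' x : ~~ (1 <= x <= nn%:Z) -> nu x = 0.
  by move=> /negP xn; apply: nu_supp; rewrite brE.
have avgE f : avg (bracket N) f = (\sum_(x < nn) f x.+1%:Z) / nn%:R.
  have [||_ ->] := avg_reindex (h := fun i : 'I_nn => i.+1%:Z) (A := bracket N) f.
  - by move=> i j [] /val_inj.
  - by move=> x; rewrite brE /= bracket_ord.
  by rewrite card_ord.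
have g_le j x : cmod (g j x) <= majorant nn nu (fun j => (j \in S)%:R) (fun j => 1 - (j \in S)%:R) j x.
  rewrite /majorant; have [jS|jS] := boolP (j \in S).
    by rewrite mul1r subrr mul0r addr0 gS.
  by rewrite mul0r subr0 mul1r add0r -(indic_bracket nnN) gnS.
have nu_le x : nu x <= Rnu N nu by apply: le_Rnu nnN _.
have R1 := Rnu_ge1 N nu.
have boundE : bound = (part1_const d C0 + part2_const d C0) *
    ((eta + L^-1 + H%:R^-1) `^ (2 ^+ #|{: 'I_d + 'I_d}|)^-1 + Rnu N nu ^+ #|{: 'I_d + 'I_d}|.+1 / B).
  rewrite /bound /c /eta_star card_sum !card_ord powR_mulrn ?(le_trans _ R1) //.
  by rewrite subn1 /= mul2n addnn.
set err := _ `^ _ + _ in boundE.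
have err0 : 0 <= err.
  by rewrite addr_ge0 ?powR_ge0 // divr_ge0 ?exprn_ge0 ?(le_trans _ R1) ?(le_trans _ B1).
have C00 : 0 <= C0 by apply: le_trans C01.
have p1 : 0 <= part1_const d C0.
  apply: mulr_ge0; first by rewrite exprn_ge0 ?mulr_ge0.
  by apply: addr_ge0; rewrite !mulr_ge0 ?exprn_ge0 ?count_const_ge0.
have p2 : 0 <= part2_const d C0.
  apply: mulr_ge0; first by rewrite exprn_ge0 ?mulr_ge0.
  by apply: addr_ge0; rewrite !mulr_ge0 ?exprn_ge0.
rewrite boundE; split.
  rewrite avgE normrM (ger0_norm (x := nn%:R^-1)) ?invr_ge0 //.
  have := weighted_average_bound lfc nnN nn0 H0 d0 B1 L2 eta01 nu0 nu_supp' C01 btP K_ge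
    mu_le mu_supp g_le R1 nu_le.
  by move=> /le_trans; apply; rewrite ler_wpM2r // lerDl.
rewrite avgE.
have KK : (2 * C0 + 1) ^+ d <= Kbd.
  have Cs0 := le_trans C00 C0sup.
  rewrite /Kbd subn1 /= lerXn2r ?nnegrE ?addr_ge0 ?mulr_ge0 //.
  by rewrite lerD2r ler_wpM2l.
have := clip_average_bound lfc nnN nn0 H0 d0 B1 L2 eta01 nu0 C01 btP K_ge
    mu_le mu_supp g_le R1 nu_le KK.
move=> h; apply: le_trans (le_trans _ h) _; last by rewrite ler_wpM2r // lerDr.
(* On [N] the indicator in [Dsharp] is 1, so only the clipping remains. *)
rewrite le_eqVlt; apply/orP; left; apply/eqP; congr (_ / _); apply: eq_bigr => x _.
by rewrite /Dsharp (indic_bracket nnN) indN_ord mul1r.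
Qed.
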